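(* Let $o$ be an ordinal number, let $A$ be a well-ordered alphabet of order type $o$, let $\mathrm{BF}(o)$ be the big free group on $A$ and $\Gamma(\mathrm{BF}(o))$ its big Cayley graph, and let $\mathbb R^o=\prod_{a\in A}\mathbb R$ carry the lexicographic order. The function $$d\big((w,a^p,t),(v,b^q,s)\big)=L(w)+tL(a)+L(v)+sL(b)-2\min\{L(w)+tL(a),\;L(v)+sL(b),\;c(wa^p,vb^q)\}$$ is an $\mathbb R^o$-metric on $\Gamma(\mathrm{BF}(o))$ under which $\Gamma(\mathrm{BF}(o))$ is $0$-hyperbolic and the action of $\mathrm{BF}(o)$ on $\Gamma(\mathrm{BF}(o))$ is by isometries. Moreover, $\Gamma(\mathrm{BF}(o))$ with this metric embeds isometrically in an $\mathbb R^o$-tree, in such a way that the action of $\mathrm{BF}(o)$ on $\Gamma(\mathrm{BF}(o))$ extends to an isometric action on that $\mathbb R^o$-tree. For $o=\omega$, the space $\Gamma(\mathrm{BF}(\omega))$ with this metric is not itself an $\mathbb R^\omega$-tree.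
   Context: **Big free groups.** Let $A$ be a well-ordered set of order type $o$ and $A^{-1}$ a disjoint set of formal inverses, with $(a^{-1})^{-1}=a$. A transfinite word is a function $w:S\to A\cup A^{-1}$ with $S$ totally ordered and $w^{-1}(\{x\})$ finite for every $x\in A\cup A^{-1}$. Words $w_1:S_1\to A\cup A^{-1}$, $w_2:S_2\to A\cup A^{-1}$ are identified if there is an order-preserving bijection $\phi:S_1\to S_2$ with $w_2\circ\phi=w_1$. A cancellation of $w$ is a subset $T\subset S$ with an involution $*:T\to T$ such that for each $t\in T$: the interval of $S$ with endpoints $t$ and $t^*$ is contained in $T$; this interval is mapped onto itself by $*$; and $w(t^* )=w(t)^{-1}$. Then the restriction of $w$ to $S\setminus T$ is said to arise from $w$ by the cancellation; the equivalence relation on words generated by this relation is used. A word is reduced if it admits no nonempty cancellation; each equivalence class contains exactly one reduced word (up to identification). $\mathrm{BF}(o)$ is the group of equivalence classes (equivalently, of reduced words) under concatenation, with inverse $w^{-1}$ obtained by reversing the order of $S$ and inverting each letter. Its identity is the empty word $\iota$. A reduced word $w:S\to A\cup A^{-1}$ ends in the letter $x$ if $S$ has a last element and $w$ takes the value $x$ there. **Length.** For $w\in\mathrm{BF}(o)$, $L(w)=(n_a)_{a\in A}\in\mathbb Z^o\subset\mathbb R^o$, where $n_a$ is the number of occurrences of $a$ and $a^{-1}$ in the reduced form of $w$; $c(g,h)=\frac12(L(g)+L(h)-L(g^{-1}h))$ for $g,h\in\mathrm{BF}(o)$. **Big Cayley graph.** $\Gamma(\mathrm{BF}(o))$ is the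 set obtained from ''big intervals'' $I_w$ ($w$ reduced), each formed from the Dedekind cuts of the domain of $w$ by inserting a real interval $(0,1)$, labeled by $w(s)$, between the adjacent cuts $(-\infty,s)$ and $(-\infty,s]$, and, for each pair of words, identifying the largest initial segments on which all the labels agree. Concretely, its points are represented uniquely as: the reduced words $w\in\mathrm{BF}(o)$ (the case $t=0$, in which no letter is recorded), and the triples $(w,a^p,t)$ with $w\in\mathrm{BF}(o)$ reduced, $a\in A$, $p\in\{1,-1\}$, $t\in(0,1)$, and $w$ not ending in $a^{-p}$. In the formula for $d$, a point given by a word $w$ (with $t=0$) is treated by replacing $tL(a)$ by $0$ and $wa^p$ by $w$. The action of $u\in\mathrm{BF}(o)$: words are sent to $u\cdot w=uw$; $u\cdot(w,a^p,t)=(uw,a^p,t)$ if (the reduced form of) $uw$ does not end in $a^{-p}$, and $u\cdot(w,a^p,t)=(uwa^p,a^{-p},1-t)$ if it does. **Order.** The lexicographic order on $\mathbb R^o$: $(s_a)<(t_a)$ iff there is $a\in A$ with $s_a<t_a$ and $s_b=t_b$ for all $b<a$. This makes $\mathbb R^o$ a (totally) ordered abelian group. **$\Lambda$-metric spaces and $\Lambda$-trees.** For an ordered abelian group $\Lambda$, a $\Lambda$-metric on $X$ is $d:X\times X\to\Lambda$ satisfying the usual metric axioms. $\Lambda$ itself has the metric $|a-b|$. A segment in $X$ is the image of a distance-preserving map $[a,b]_\Lambda\to X$, where $[a,b]_\Lambda=\{x\in\Lambda:a\le x\le b\}$; the images of $a,b$ are its endpoints. $X$ is geodesic if any two points are the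 endpoints of a segment. A $\Lambda$-tree is a geodesic $\Lambda$-metric space such that (1) if two segments intersect in a single point which is an endpoint of both, their union is a segment; (2) if two segments have a common endpoint, their intersection is a segment. With $(x\cdot y)_v=\frac12(d(v,x)+d(v,y)-d(x,y))$, $X$ is $0$-hyperbolic if $(x\cdot y)_v\ge\min\{(x\cdot z)_v,(y\cdot z)_v\}$ for all $v,x,y,z\in X$. *)

(* Defs.v *)
From HB Require Import structures.
From Stdlib Require Import Relations.
From mathcomp Require Import all_boot all_order all_algebra.
From mathcomp Require Import all_classical all_reals.

Set SsrOldRewriteGoalsOrder.
Set Implicit Arguments.
Unset Strict Implicit.
Unset Printing Implicit Defensive.

Import Order.TTheory GRing.Theory Num.Theory.
Local Open Scope classical_set_scope.
Local Open Scope ring_scope.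
Local Open Scope quotient_scope.

(** * Ordered abelian groups, Lambda-metric spaces and Lambda-trees *)

HB.mixin Record POrderedZmodule_isOrderedAbGroup G
    of Num.POrderedZmodule G := {
  le_tot : total (<=%R : rel G);
  le_transl : forall z x y : G, x <= y -> x + z <= y + z
}.

#[short(type="orderedAbGroupType")]
HB.structure Definition OrderedAbGroup :=
  {G of POrderedZmodule_isOrderedAbGroup G & Num.POrderedZmodule G}.

Section LambdaMetric.
Variables (L : orderedAbGroupType) (T : Type).
Implicit Types (X S : set T) (dist : T -> T -> L) (x y z : T).

Definition absv (u : L) : L := Order.max u (- u).

(* The spaces are subsets [X] of a carrier type [T]; the values of [dist]
   outside [X] are irrelevant. *)
Record is_metric X dist : Prop := IsMetric {
  dist_ge0 : forall x y, X x -> X y -> 0 <= dist x y;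
  dist_eq0 : forall x y, X x -> X y -> (dist x y = 0 <-> x = y);
  dist_sym : forall x y, X x -> X y -> dist x y = dist y x;
  dist_triangle : forall x y z, X x -> X y -> X z ->
    dist x z <= dist x y + dist y z
}.

Definition segment_between X dist S x y : Prop :=
  exists (a b : L) (f : L -> T),
    [/\ a <= b,
        (forall s, a <= s <= b -> X (f s)),
        (forall s t, a <= s <= b -> a <= t <= b ->
           dist (f s) (f t) = absv (s - t)),
        S = f @` [set s | a <= s <= b]
      & f a = x /\ f b = y].

Definition segment X dist S : Prop :=
  exists x y, segment_between X dist S x y.

Definition endpoint X dist S x : Prop :=
  exists y, segment_between X dist S x y \/ segment_between X dist S y x.

Definition geodesic X dist : Prop :=
  forall x y, X x -> X y -> exists S, segment_between X dist S x y.

Record is_tree X dist : Prop := IsTree {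
  tree_metric : is_metric X dist;
  tree_geodesic : geodesic X dist;
  tree_union : forall S1 S2 x,
    endpoint X dist S1 x -> endpoint X dist S2 x -> S1 `&` S2 = [set x] ->
    segment X dist (S1 `|` S2);
  tree_inter : forall S1 S2 x,
    endpoint X dist S1 x -> endpoint X dist S2 x ->
    segment X dist (S1 `&` S2)
}.

Record isometric_action (G : groupType) X dist (act : G -> T -> T) : Prop :=
  IsometricAction {
    act_stable : forall g x, X x -> X (act g x);
    act1 : forall x, X x -> act 1%g x = x;
    actM : forall g h x, X x -> act (g * h)%g x = act g (act h x);
    act_isometry : forall g x y, X x -> X y ->
      dist (act g x) (act g y) = dist x y
  }.

End LambdaMetric.

(** * Well-ordered alphabets and the lexicographic group R^A *)

HB.mixin Record Total_isWellOrder (d : Order.disp_t) A of Order.Total d A := {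
  lt_wf : well_founded (fun x y : A => (x < y)%O)
}.

#[short(type="wellOrderType")]
HB.structure Definition WellOrder (d : Order.disp_t) :=
  {A of Total_isWellOrder d A & Order.Total d A}.

Definition order_type_omega (d : Order.disp_t) (A : wellOrderType d) : Prop :=
  exists f : nat -> A,
    bijective f /\ {mono f : m n / (m <= n)%N >-> (m <= n)%O}.

(* An alias of [A -> R] with pointwise addition and scaling, ordered
   lexicographically. *)
Definition lexpow (d : Order.disp_t) (A : wellOrderType d) (R : realType) :
  Type := A -> R.

Section LexPow.
Context (d : Order.disp_t) (A : wellOrderType d) (R : realType).

HB.instance Definition _ := GRing.Lmodule.copy (lexpow A R) (A -> R^o).

Implicit Types s t u : lexpow A R.

Definition lex_lt : rel (lexpow A R) := fun s t =>
  `[< exists2 a, s a < t a & forall b, (b < a)%O -> s b = t b >].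

Lemma lex_lt_irr : irreflexive lex_lt.
Proof. by move=> s; apply/asboolP => -[a]; rewrite ltxx. Qed.

Lemma lex_lt_trans : transitive lex_lt.
Proof.
move=> t s u /asboolP[a sta eqa] /asboolP[b tub eqb]; apply/asboolP.
case: (ltgtP a b) => [ab|ba|eab].
- exists a => [|c ca]; first by rewrite -eqb.
  by rewrite eqa // eqb // (lt_trans ca ab).
- exists b => [|c cb]; first by rewrite eqa.
  by rewrite eqa ?eqb // (lt_trans cb ba).
- exists a => [|c ca]; first by rewrite (lt_trans sta) // eab.
  by rewrite eqa // eqb // -eab.
Qed.

HB.instance Definition _ := Order.Lt_isPOrder.Build ring_display (lexpow A R)
  lex_lt_irr lex_lt_trans.

Lemma lex_ltE s t :
  s < t <-> exists2 a, s a < t a & forall b, (b < a)%O -> s b = t b.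
Proof. by split=> /asboolP. Qed.

Lemma lex_total : total (<=%R : rel (lexpow A R)).
Proof.
move=> s t; case: (eqVneq s t) => [->|nst]; first by rewrite lexx.
have [a nea] : exists a, s a <> t a.
  by apply: contrapT => h; case/eqP: nst; apply/funext => a;
    apply: contrapT => na; apply: h; exists a.
have [b [neb minb]] : exists b, s b <> t b /\ forall c, (c < b)%O -> s c = t c.
  elim/(well_founded_ind (@lt_wf d A)): a nea => a IH nea.
  case: (pselect (exists2 c, (c < a)%O & s c <> t c)) => [[c ca nc]|h].
    exact: IH ca nc.
  exists a; split=> // c ca; apply: contrapT => nc.
  by apply: h; exists c.
apply/orP; case: (ltgtP (s b) (t b)) => [lt|lt|//].
- by left; apply/ltW/lex_ltE; exists b.
- by right; apply/ltW/lex_ltE; exists b => // c cb; rewrite minb.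
Qed.

HB.instance Definition _ :=
  Order.POrder_isTotal.Build ring_display (lexpow A R) lex_total.

Lemma lex_le_transl u s t : s <= t -> s + u <= t + u.
Proof.
rewrite le_eqVlt => /orP[/eqP->//|/lex_ltE[a sta eqa]].
apply/ltW/lex_ltE; exists a => [|b ba].
- by rewrite /GRing.add /= ltrD2r.
- by rewrite /GRing.add /= eqa.
Qed.

HB.instance Definition _ :=
  POrderedZmodule_isOrderedAbGroup.Build (lexpow A R)
    lex_total lex_le_transl.

Section Hyperbolic.
Variables (T : Type) (X : set T) (dist : T -> T -> lexpow A R).

Definition gromov_product (v x y : T) : lexpow A R :=
  2^-1 *: (dist v x + dist v y - dist x y).

Definition zero_hyperbolic : Prop :=
  forall v x y z, X v -> X x -> X y -> X z ->
    Order.min (gromov_product v x z) (gromov_product v y z)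
      <= gromov_product v x y.

End Hyperbolic.
End LexPow.

(** * Transfinite words *)

(* [(a, true)] stands for the letter [a] and [(a, false)] for its formal
   inverse. *)
Definition sletter (A : Type) : Type := A * bool.

Definition sinv (A : Type) (x : sletter A) : sletter A := (x.1, ~~ x.2).

Record word (A : Type) := Word {
  dom : Type;
  wle : rel dom;
  letter : dom -> sletter A;
  wle_anti : antisymmetric wle;
  wle_trans : transitive wle;
  wle_total : total wle;
  letter_fin : forall x, finite_set (letter @^-1` [set x])
}.

HB.instance Definition _ (A : Type) := gen_eqMixin (word A).
HB.instance Definition _ (A : Type) := gen_choiceMixin (word A).

Local Obligation Tactic := idtac.

Section Words.
Variable A : Type.
Implicit Types w v : word A.

Lemma sinvK : involutive (@sinv A).
Proof. by case=> a b; rewrite /sinv /= negbK. Qed.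

Definition word_iso w v : Prop :=
  exists phi : dom w -> dom v,
    [/\ bijective phi, {mono phi : s t / wle s t}
      & forall s, letter (phi s) = letter s].

Program Definition restrict w (P : set (dom w)) : word A :=
  @Word A {s : dom w | P s} (fun s t => wle (sval s) (sval t))
    (fun s => letter (sval s)) _ _ _ _.
Next Obligation.
move=> w P s t /wle_anti/eq_sig_hprop; apply=> x p q.
exact: Prop_irrelevance.
Qed.
Next Obligation.
by move=> w P t s u; apply: wle_trans.
Qed.
Next Obligation.
by move=> w P s t; apply: wle_total.
Qed.
Next Obligation.
move=> w P x; apply: (@finite_preimage {s | P s} (dom w) (@letter _ w @^-1` [set x]) sval).
  move=> s t _ _ /eq_sig_hprop; apply=> y p q; exact: Prop_irrelevance.
exact: letter_fin.
Qed.

Program Definition wempty : word A :=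
  @Word A void (fun _ _ => true) (fun s => match s with end) _ _ _ _.
Next Obligation. by case. Qed.
Next Obligation. by case. Qed.
Next Obligation. by case. Qed.
Next Obligation.
by move=> x; apply: (@sub_finite_set _ _ set0) => [[]|]; exact: finite_set0.
Qed.

Program Definition wletter (x : sletter A) : word A :=
  @Word A unit (fun _ _ => true) (fun=> x) _ _ _ _.
Next Obligation. by move=> x [] []. Qed.
Next Obligation. by []. Qed.
Next Obligation. by []. Qed.
Next Obligation.
move=> x y; apply: (@sub_finite_set _ _ [set tt]) => [[]|] //.
Qed.

Program Definition winv w : word A :=
  @Word A (dom w) (fun s t => wle t s) (fun s => sinv (letter s)) _ _ _ _.
Next Obligation. by move=> w s t; rewrite andbC => /wle_anti. Qed.
Next Obligation. by move=> w t s u st tu; apply: wle_trans tu st. Qed.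
Next Obligation. by move=> w s t; apply: wle_total. Qed.
Next Obligation.
move=> w x; apply: (@sub_finite_set _ _ _ _ (@letter_fin _ w (sinv x))).
by move=> s /= <-; rewrite sinvK.
Qed.

Definition cat_le w v : rel (dom w + dom v) := fun s t =>
  match s, t with
  | inl s, inl t => wle s t
  | inl _, inr _ => true
  | inr _, inl _ => false
  | inr s, inr t => wle s t
  end.

Definition cat_letter w v (s : dom w + dom v) : sletter A :=
  match s with inl s => letter s | inr s => letter s end.

Program Definition wcat w v : word A :=
  @Word A (dom w + dom v) (@cat_le w v) (@cat_letter w v) _ _ _ _.
Next Obligation.
by move=> w v [s|s] [t|t] //= /wle_anti ->.
Qed.
Next Obligation.
by move=> w v [t|t] [s|s] [u|u] //=; apply: wle_trans.
Qed.
Next Obligation.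
by move=> w v [s|s] [t|t] //=; apply: wle_total.
Qed.
Next Obligation.
move=> w v x.
apply: (@sub_finite_set _ _ ((inl @` (@letter _ w @^-1` [set x]))
                           `|` (inr @` (@letter _ v @^-1` [set x])))).
  by move=> [s|s] /= <-; [left|right]; exists s.
by rewrite finite_setU; split; apply/finite_image/letter_fin.
Qed.

Definition between w (s t : dom w) : set (dom w) :=
  [set r | wle s r && wle r t || wle t r && wle r s].

(* Only the values of [star] on [T] matter. *)
Definition cancellation w (T : set (dom w)) : Prop :=
  exists star : dom w -> dom w,
    [/\ (forall t, T t -> T (star t)),
        (forall t, T t -> star (star t) = t),
        (forall t, T t -> between t (star t) `<=` T),
        (forall t, T t -> star @` between t (star t) = between t (star t))
      & (forall t, T t -> letter (star t) = sinv (letter t))].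

(* The empty cancellation is allowed, so isomorphic words are related. *)
Definition cancels_to w v : Prop :=
  exists T : set (dom w), cancellation T /\ word_iso (restrict (~` T)) v.

Definition word_equiv : word A -> word A -> Prop :=
  clos_refl_sym_trans _ cancels_to.

Definition word_equivb : rel (word A) := fun w v => `[< word_equiv w v >].

Definition reduced w : Prop :=
  forall T : set (dom w), cancellation T -> T = set0.

Definition word_ends_in w (x : sletter A) : Prop :=
  exists2 s : dom w, (forall t, wle t s) & letter s = x.

Lemma word_equivb_refl : reflexive word_equivb.
Proof. by move=> w; apply/asboolP; apply: rst_refl. Qed.

Lemma word_equivb_sym : symmetric word_equivb.
Proof. by move=> w v; apply/asboolP/asboolP; apply: rst_sym. Qed.

Lemma word_equivb_trans : transitive word_equivb.
Proof.
by move=> v w u /asboolP wv /asboolP vu; apply/asboolP; apply: rst_trans wv vu.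
Qed.

Canonical word_equiv_rel :=
  EquivRel word_equivb word_equivb_refl word_equivb_sym word_equivb_trans.

End Words.

(** * The big free group *)

Definition bigfree (A : Type) : Type := {eq_quot (@word_equiv_rel A)}.
HB.instance Definition _ (A : Type) := EqQuotient.on (bigfree A).
HB.instance Definition _ (A : Type) := Choice.on (bigfree A).

Section BigFree.
Variable A : Type.
Implicit Types (w v u : word A) (g h : bigfree A).

Definition bf w : bigfree A := \pi_(bigfree A) w.

Definition bf_one : bigfree A := bf (wempty A).
Definition bf_mul g h : bigfree A := bf (wcat (repr g) (repr h)).
Definition bf_inv g : bigfree A := bf (winv (repr g)).

Lemma bfP w v : bf w = bf v <-> word_equiv w v.
Proof.
split=> [/eqquotP/asboolP //|wv].
by apply/eqquotP; apply/asboolP.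
Qed.

Lemma bf_repr g : bf (repr g) = g.
Proof. exact: reprK. Qed.

Lemma repr_bf w : word_equiv (repr (bf w)) w.
Proof. by apply/bfP; rewrite bf_repr. Qed.

Lemma cancels_toP w v (T : set (dom w)) (phi : dom v -> dom w) :
    cancellation T -> injective phi -> {mono phi : s t / wle s t} ->
    (forall s, letter (phi s) = letter s) -> range phi = ~` T ->
  cancels_to w v.
Proof.
move=> cT phi_inj phi_mono phi_let rphi.
exists T; split=> //.
have inv (s : {s | (~` T) s}) : exists t, phi t = sval s.
  by have := svalP s; rewrite -[X in X (sval s)]rphi => -[t _ <-]; exists t.
have mem t : (~` T) (phi t) by rewrite -rphi; exists t.
pose psi (s : {s | (~` T) s}) : dom v := projT1 (cid (inv s)).
have psiK s : phi (psi s) = sval s by rewrite /psi; case: cid.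
exists psi; split.
- exists (fun t => exist _ (phi t) (mem t)) => [s|t].
    by apply: eq_sig_hprop => [? ? ?|/=]; [exact: Prop_irrelevance|exact: psiK].
  by apply: phi_inj; rewrite psiK.
- by move=> s t; rewrite -phi_mono !psiK.
- by move=> s; rewrite -phi_let psiK.
Qed.

Lemma cancels_toE w v : cancels_to w v ->
  exists (T : set (dom w)) (phi : dom v -> dom w),
    [/\ cancellation T, injective phi, {mono phi : s t / wle s t},
        forall s, letter (phi s) = letter s & range phi = ~` T].
Proof.
move=> [T [cT [psi [[phi psiK phiK] psi_mono psi_let]]]].
exists T, (fun t => sval (phi t)); split=> //.
- move=> s t /eq_sig_hprop eqphi; apply: (can_inj phiK).
  by apply: eqphi => ? ? ?; exact: Prop_irrelevance.
- by move=> s t; rewrite -{2}(phiK s) -{2}(phiK t) psi_mono.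
- by move=> s; rewrite -{2}(phiK s) psi_let.
- apply/seteqP; split=> [_ [t _ <-]|s Ts].
    exact: svalP (phi t).
  by exists (psi (exist _ s Ts)) => //; rewrite psiK.
Qed.

Lemma cancellation0 w : cancellation (set0 : set (dom w)).
Proof. by exists id; split. Qed.

Lemma iso_equiv w v : word_iso w v -> word_equiv w v.
Proof.
move=> [phi [[psi phiK psiK] phi_mono phi_let]]; apply: rst_step.
apply: (@cancels_toP w v set0 psi).
- exact: cancellation0.
- exact: can_inj psiK.
- by move=> s t; rewrite -phi_mono !psiK.
- by move=> s; rewrite -phi_let psiK.
- by rewrite setC0; apply/seteqP; split=> // s _; exists (phi s).
Qed.

Lemma cancels_catr w v u : cancels_to w v -> cancels_to (wcat w u) (wcat v u).
Proof.
move=> /cancels_toE[T [phi [[star [sT ss sb sbb sl]] phi_inj mphi lphi rphi]]].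
have btw (s t : dom w) :
    @between _ (wcat w u) (inl s) (inl t) = inl @` between s t.
  apply/seteqP; split=> [[r|r] rb|_ [r rb <-]//]; first by exists r.
  by move: rb; rewrite /between /= ?andbF.
pose star' (x : dom (wcat w u)) : dom (wcat w u) :=
  match x with inl s => inl (star s) | inr s => inr s end.
pose phi' (x : dom (wcat v u)) : dom (wcat w u) :=
  match x with inl s => inl (phi s) | inr s => inr s end.
apply: (@cancels_toP (wcat w u) (wcat v u) (inl @` T) phi').
- exists star'; split=> _ [t Tt <-] /=.
  + by exists (star t) => //; exact: sT.
  + by rewrite ss.
  + by rewrite btw; apply: image_subset; apply: sb.
  + rewrite btw -{2}(sbb t Tt); apply/seteqP; split.
      by move=> _ [_ [r rb <-] <-] /=; exists (star r) => //; exists r.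
    by move=> _ [_ [r rb <-] <-] /=; exists (inl r) => //; exists r.
  + exact: sl.
- by move=> [s|s] [t|t] //= [] => [/phi_inj|] ->.
- by move=> [s|s] [t|t] //=; apply: mphi.
- by move=> [s|s] //=; apply: lphi.
- apply/seteqP; split=> [_ [[s|s] _ <-] /=|[s|s] /= h].
  + move=> [t Tt [ets]]; have : (~` T) (phi s) by rewrite -rphi; exists s.
    by rewrite -ets.
  + by move=> [].
  + have : (~` T) s by move=> Ts; apply: h; exists s.
    by rewrite -rphi => -[t _ <-]; exists (inl t).
  + by exists (inr s).
Qed.

Lemma cancels_catl w v u : cancels_to w v -> cancels_to (wcat u w) (wcat u v).
Proof.
move=> /cancels_toE[T [phi [[star [sT ss sb sbb sl]] phi_inj mphi lphi rphi]]].
have btw (s t : dom w) :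
    @between _ (wcat u w) (inr s) (inr t) = inr @` between s t.
  apply/seteqP; split=> [[r|r] rb|_ [r rb <-]//]; last by exists r.
  by move: rb; rewrite /between /= ?andbF.
pose star' (x : dom (wcat u w)) : dom (wcat u w) :=
  match x with inr s => inr (star s) | inl s => inl s end.
pose phi' (x : dom (wcat u v)) : dom (wcat u w) :=
  match x with inr s => inr (phi s) | inl s => inl s end.
apply: (@cancels_toP (wcat u w) (wcat u v) (inr @` T) phi').
- exists star'; split=> _ [t Tt <-] /=.
  + by exists (star t) => //; exact: sT.
  + by rewrite ss.
  + by rewrite btw; apply: image_subset; apply: sb.
  + rewrite btw -{2}(sbb t Tt); apply/seteqP; split.
      by move=> _ [_ [r rb <-] <-] /=; exists (star r) => //; exists r.
    by move=> _ [_ [r rb <-] <-] /=; exists (inr r) => //; exists r.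
  + exact: sl.
- by move=> [s|s] [t|t] //= [] => [|/phi_inj] ->.
- by move=> [s|s] [t|t] //=; apply: mphi.
- by move=> [s|s] //=; apply: lphi.
- apply/seteqP; split=> [_ [[s|s] _ <-] /=|[s|s] /= h].
  + by move=> [].
  + move=> [t Tt [ets]]; have : (~` T) (phi s) by rewrite -rphi; exists s.
    by rewrite -ets.
  + by exists (inl s).
  + have : (~` T) s by move=> Ts; apply: h; exists s.
    by rewrite -rphi => -[t _ <-]; exists (inr t).
Qed.

Lemma cancels_inv w v : cancels_to w v -> cancels_to (winv w) (winv v).
Proof.
move=> /cancels_toE[T [phi [[star [sT ss sb sbb sl]] phi_inj mphi lphi rphi]]].
have btw (s t : dom w) : @between _ (winv w) s t = between s t.
  by apply/seteqP; split=> r; rewrite /between /= orbC ![wle _ r && _]andbC.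
apply: (@cancels_toP (winv w) (winv v) T phi) => //.
- exists star; split=> t Tt //=.
  + exact: sT.
  + exact: ss.
  + by rewrite btw; apply: sb.
  + by rewrite btw; apply: sbb.
  + by rewrite sl.
- by move=> s t; rewrite /= mphi.
- by move=> s; rewrite /= lphi.
Qed.

Lemma equiv_lift (f : word A -> word A) :
    (forall w v, cancels_to w v -> cancels_to (f w) (f v)) ->
  forall w v, word_equiv w v -> word_equiv (f w) (f v).
Proof.
move=> fP w v; elim=> [x y /fP|x|x y _|x y z _ xy _ yz].
- exact: rst_step.
- exact: rst_refl.
- exact: rst_sym.
- exact: rst_trans xy yz.
Qed.

Lemma equiv_cat w w' v v' :
  word_equiv w w' -> word_equiv v v' -> word_equiv (wcat w v) (wcat w' v').
Proof.
move=> ww vv; apply: (@rst_trans _ _ _ (wcat w' v)).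
- by apply: (equiv_lift (f := fun x => wcat x v)) ww => x y /cancels_catr.
- by apply: (equiv_lift (f := wcat w')) vv => x y /cancels_catl.
Qed.

Lemma equiv_inv w v : word_equiv w v -> word_equiv (winv w) (winv v).
Proof. exact: equiv_lift cancels_inv w v. Qed.

Lemma bf_mulE w v : bf_mul (bf w) (bf v) = bf (wcat w v).
Proof. by apply/bfP; apply: equiv_cat; apply: repr_bf. Qed.

Lemma bf_invE w : bf_inv (bf w) = bf (winv w).
Proof. by apply/bfP; apply: equiv_inv; apply: repr_bf. Qed.

Lemma bf_mulA : associative bf_mul.
Proof.
move=> g h k; rewrite -(bf_repr g) -(bf_repr h) -(bf_repr k) !bf_mulE.
apply/bfP; apply: iso_equiv.
exists (fun x => match x with
  | inl s => inl (inl s) | inr (inl s) => inl (inr s) | inr (inr s) => inr s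
  end); split.
- exists (fun x => match x with
    | inl (inl s) => inl s | inl (inr s) => inr (inl s) | inr s => inr (inr s)
    end); by [move=> [s|[s|s]] | move=> [[s|s]|s]].
- by move=> [s|[s|s]] [t|[t|t]].
- by move=> [s|[s|s]].
Qed.

Lemma bf_mul1g : left_id bf_one bf_mul.
Proof.
move=> g; rewrite -(bf_repr g) bf_mulE; apply/bfP; apply: iso_equiv.
pose phi (x : dom (wcat (wempty A) (repr g))) : dom (repr g) :=
  match x with inl s => match s with end | inr s => s end.
by exists phi; split=> [|[[]|s] [[]|t]|[[]|s]] //; exists inr => // -[[]|].
Qed.

Lemma bf_mulg1 : right_id bf_one bf_mul.
Proof.
move=> g; rewrite -(bf_repr g) bf_mulE; apply/bfP; apply: iso_equiv.
pose phi (x : dom (wcat (repr g) (wempty A))) : dom (repr g) :=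
  match x with inr s => match s with end | inl s => s end.
by exists phi; split=> [|[s|[]] [t|[]]|[s|[]]] //; exists inl => // -[|[]].
Qed.

Lemma bf_mulVg : left_inverse bf_one bf_inv bf_mul.
Proof.
move=> g; rewrite -(bf_repr g) bf_invE bf_mulE; apply/bfP; apply: rst_step.
set w := repr g.
pose phi (x : dom (wempty A)) : dom (wcat (winv w) w) := match x with end.
apply: (@cancels_toP _ (wempty A) setT phi); [|by case..|]; last first.
  by rewrite setCT; apply/seteqP; split=> // _ [[]].
pose star (x : dom (wcat (winv w) w)) : dom (wcat (winv w) w) :=
  match x with inl s => inr s | inr s => inl s end.
have starK : involutive star by case.
exists star; split=> // t _; last by case: t => s //=; rewrite sinvK.
have sub : star @` between t (star t) `<=` between t (star t).
  move=> _ [r rb <-]; move: rb; case: r => r; case: t => t; rewrite /between /=;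
    by rewrite ?andbT ?andbF ?orbF.
apply/seteqP; split=> // r rb; exists (star r); last exact: starK.
by apply: sub; exists r.
Qed.

Lemma bf_invK : involutive bf_inv.
Proof.
move=> g; rewrite -(bf_repr g) !bf_invE; apply/bfP; apply: iso_equiv.
by exists id; split=> // [|s]; [exists id | rewrite /= sinvK].
Qed.

Lemma bf_mulgV : right_inverse bf_one bf_inv bf_mul.
Proof. by move=> g; rewrite -{1}(bf_invK g) bf_mulVg. Qed.

HB.instance Definition _ := isGroup.Build (bigfree A)
  bf_mulA bf_mul1g bf_mulg1 bf_mulVg bf_mulgV.

Definition bf_letter (x : sletter A) : bigfree A := bf (wletter x).

(* The reduced words in a class are all isomorphic; [reduced_form] picks one of
   them. *)
Definition reduced_form g : word A :=
  xget (wempty A) [set w | reduced w /\ bf w = g].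

Definition ends_in g (x : sletter A) : Prop :=
  word_ends_in (reduced_form g) x.

(* The number of elements of a finite set; 0 on infinite sets. *)
Definition ncard (T : Type) (S : set T) : nat :=
  xget 0%N [set n | (S #= `I_n)%card].

Definition occurrences w (a : A) : nat :=
  ncard [set s : dom w | (letter s).1 = a].

End BigFree.

(** * The big Cayley graph *)

(* [Vertex w] is the point given by the word [w], and [Edge w a p t] is the
   triple (w, a^p, t), with [p = true] for exponent 1 and [p = false] for
   exponent -1. *)
Inductive prepoint (A : Type) (R : Type) :=
| Vertex of bigfree A
| Edge of bigfree A & A & bool & R.

Arguments Vertex {A R}.
Arguments Edge {A R}.

Section CayleyGraph.
Context (d : Order.disp_t) (A : wellOrderType d) (R : realType).
Implicit Types (g h u : bigfree A) (x y : prepoint A R).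

Definition bf_length g : lexpow A R :=
  fun a => (occurrences (reduced_form g) a)%:R.

Definition overlap g h : lexpow A R :=
  2^-1 *: (bf_length g + bf_length h - bf_length (g^-1 * h)%g).

Definition cayley : set (prepoint A R) := fun x =>
  match x with
  | Vertex _ => True
  | Edge w a p t => 0 < t < 1 /\ ~ ends_in w (a, ~~ p)
  end.

(* L(w) + t L(a) *)
Definition height x : lexpow A R :=
  match x with
  | Vertex w => bf_length w
  | Edge w a _ t => bf_length w + t *: bf_length (bf_letter (a, true))
  end.

(* w a^p *)
Definition tip x : bigfree A :=
  match x with
  | Vertex w => w
  | Edge w a p _ => (w * bf_letter (a, p))%g
  end.

Definition cayley_dist x y : lexpow A R :=
  height x + height y
    - 2 *: Order.min (height x) (Order.min (height y) (overlap (tip x) (tip y))).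

Definition cayley_act u x : prepoint A R :=
  match x with
  | Vertex w => Vertex (u * w)%g
  | Edge w a p t =>
      if `[< ends_in (u * w)%g (a, ~~ p) >]
      then Edge (u * w * bf_letter (a, p))%g a (~~ p) (1 - t)
      else Edge (u * w)%g a p t
  end.

End CayleyGraph.

Arguments cayley {d} A R.
Arguments cayley_dist {d} A R.
Arguments cayley_act {d} A R.

(* Main.v *)
(** Write [c(g, h) = (L(g) + L(h) - L(g^-1 h)) / 2] for words. Cancelling
    maximally in [g^-1 h], for reduced words [g] and [h], pairs an initial segment
    of [g] with an initial segment of [h]; hence [c(g, h)] is the length of a common
    initial segment, and initial segments of one word being comparable, [c] is an
    ultrametric Gromov product. That lengths do not depend on the reduced form
    rests on compactness: a word whose projections to finite alphabets are all
    trivial in the free group cancels completely, an ultralimit of the finite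
    pairings being a pairing.

    The functions [z |-> d(z, P)] on [BF], for the ideal points [P] at distance [m]
    from 1 on the way to a word, form a tree under the supremum distance, on which
    [BF] acts by precomposition. Sending the point [x] of the Cayley graph to the
    function with [m = L(w) + t L(a)] on the way to [w a^p] is injective and
    equivariant, and pulls the distance of the tree back to [d]; so all the claims
    on the Cayley graph hold because they hold for the tree. Finally a vertex and
    its neighbour across an edge with letter [a] are not joined by a segment if
    some letter [b] follows [a]: no point lies at distance [L(b)] from the first. *)

Require Import Defs.
From HB Require Import structures.
From Stdlib Require Import Relation_Operators.
From mathcomp Require Import all_boot all_order all_algebra.
From mathcomp Require Import all_classical all_reals.
From mathcomp Require Import lra zify.

Set SsrOldRewriteGoalsOrder.
Set Implicit Arguments.
Unset Strict Implicit.
Unset Printing Implicit Defensive.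

Import Order.TTheory GRing.Theory Num.Theory.
Local Open Scope classical_set_scope.
Local Open Scope ring_scope.

(** Infinite words allow neither induction on length nor cancelling letter by letter, and equivalent
    words may be linked by a chain of words of other order types. What survives along the chain is
    the image in the free group on each finite set of letters; compactness applies because the
    partner of a position lies among the finitely many occurrences of the inverse letter. Points of
    the tree are functions so that gluing along common initial segments is plain equality, and the
    action needs no choice of a representative. That translation preserves these functions is seen
    by writing them as a maximum over two endpoints, where the base point has no special role; the
    same form absorbs the reversal of edges by the action. Lexicographic inequalities are not
    Archimedean, but each argument uses finitely many, and some additive functional to the reals
    reflects finitely many signs. *)

Local Notation wrestrict := Defs.restrict.

(** * Linear arithmetic in the lexicographic group *)

Section LexFunctional.
Context (d : Order.disp_t) (A : wellOrderType d) (R : realType).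
Local Notation Lam := (lexpow A R).

Lemma lexpowD (u v : Lam) a : (u + v) a = u a + v a. Proof. by []. Qed.
Lemma lexpowB (u v : Lam) a : (u - v) a = u a - v a. Proof. by []. Qed.
Lemma lexpowN (u : Lam) a : (- u) a = - u a. Proof. by []. Qed.
Lemma lexpow0 a : (0 : Lam) a = 0. Proof. by []. Qed.
Lemma lexpowZ (r : R) (u : Lam) a : (r *: u) a = r * u a. Proof. by []. Qed.

Lemma wf_min (P : set A) a : P a -> exists2 b, P b & forall c, (c < b)%O -> ~ P c.
Proof.
elim/(well_founded_ind (@lt_wf d A)): a => a IH Pa.
have [[c ca Pc]|h] := pselect (exists2 c, (c < a)%O & P c); first exact: IH ca Pc.
by exists a => // c ca Pc; apply: h; exists c.
Qed.

Lemma small_perturbation (s : seq (R * R)) :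
  (forall p, p \in s -> 0 < p.1) ->
  exists2 e, 0 < e & forall p, p \in s -> 0 < p.1 + e * p.2.
Proof.
(* The bound is required for every smaller [e'], so that the induction may shrink [e]. *)
suff [e e0 He] : exists2 e, 0 < e & forall p, p \in s -> 0 < p.1 ->
    forall e', 0 < e' -> e' <= e -> 0 < p.1 + e' * p.2.
  by move=> s0; exists e => // p ps; apply: He => //; exact: s0.
elim: s => [|[x y] s [e e0 IH]]; first by exists 1.
case: (ltP 0 y) => y0.
  exists e => // p; rewrite inE => /orP[/eqP-> /= x0 e' e'0 _|]; last exact: IH.
  by rewrite addr_gt0 ?mulr_gt0.
case: (ltP 0 x) => x0; last first.
  by exists e => // p; rewrite inE => /orP[/eqP-> /=|]; [lra|exact: IH].
(* Here [y <= 0], and [e' * (1 - y) <= x] gives [x + e' * y >= e' > 0]. *)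
exists (Num.min e (x / (1 - y))) => [|p].
  by rewrite lt_min e0 divr_gt0 //; lra.
rewrite inE => /orP[/eqP-> /= _ e' e'0|ps p0 e' e'0]; rewrite le_min => /andP[e1 e2].
  by move: e2; rewrite ler_pdivlMr; [nra|lra].
exact: IH.
Qed.

(** At the least leading index [a] of the vectors, each [v a] is positive or zero. The vectors with
    [v a = 0] are fewer and get a functional by induction; a small multiple of it, added to
    evaluation at [a], keeps the others positive. *)
Lemma lex_positive_functional (vs : seq Lam) : (forall v, v \in vs -> 0 < v) ->
  exists phi : {additive Lam -> R}, forall v, v \in vs -> 0 < phi v.
Proof.
have [n] := ubnP (size vs); elim: n vs => // n IH [_ _|v0 vs]; first by exists \0.
rewrite ltnS => sz pos.
have lead (v : Lam) : 0 < v -> exists a, 0 < v a /\ forall b, (b < a)%O -> v b = 0.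
  by move=> /lex_ltE[a a0 h]; exists a; split=> // b /h.
pose P a := exists2 v : Lam, v \in v0 :: vs & 0 < v a /\ forall b, (b < a)%O -> v b = 0.
have [a0 Pa0] : exists a, P a.
  by have [a h] := lead v0 (pos v0 (mem_head _ _)); exists a, v0; rewrite ?mem_head.
have [a [v1 v1s [v1a _]] amin] := wf_min Pa0.
have nonneg (v : Lam) : v \in v0 :: vs -> 0 < v a \/ v a = 0.
  move=> vvs; have [b [b0 bmin]] := lead v (pos v vvs).
  case: (ltgtP a b) => [ab|ba|->]; [by right; exact: bmin| |by left].
  by exfalso; apply: (amin b ba); exists v.
pose vs2 := [seq v : Lam <- v0 :: vs | v a <= 0].
have [phi2 H2] : exists phi : {additive Lam -> R}, forall v, v \in vs2 -> 0 < phi v.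
  apply: IH => [|v]; last by rewrite mem_filter => /andP[_ /pos].
  apply: (leq_trans _ sz).
  rewrite size_filter -(count_predC (fun v : Lam => v a <= 0) (v0 :: vs)).
  rewrite -[ltnLHS]addn0 ltn_add2l -has_count.
  by apply/hasP; exists v1 => //=; rewrite -ltNge.
pose vs1 := [seq (v a, phi2 v) | v : Lam <- v0 :: vs & 0 < v a].
have [e e0 He] : exists2 e, 0 < e & forall p, p \in vs1 -> 0 < p.1 + e * p.2.
  apply: small_perturbation => p /mapP[v].
  by rewrite mem_filter => /andP[va _] ->.
pose phi (v : Lam) := v a + e * phi2 v.
have phi_zm : zmod_morphism phi.
  by move=> u v; rewrite /phi raddfB /= lexpowB; lra.
exists (HB.pack_for {additive Lam -> R} phi (GRing.isZmodMorphism.Build _ _ phi phi_zm)).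
move=> v vvs /=; rewrite /phi; case: (nonneg v vvs) => va.
  by apply: (He (v a, phi2 v)); apply/mapP; exists v; rewrite // mem_filter va.
by rewrite va add0r mulr_gt0 // H2 // mem_filter va lexx.
Qed.

Lemma lex_sign_functional (vs : seq Lam) :
  exists phi : {additive Lam -> R}, forall v, v \in vs -> (0 <= phi v) = (0 <= v).
Proof.
pose ws := [seq v <- vs ++ map -%R vs | 0 < v].
have [|phi H] := @lex_positive_functional ws.
  by move=> v; rewrite mem_filter => /andP[].
exists phi => v vvs; case: (@ltgtP _ Lam 0 v) => [v0|v0|<-]; last by rewrite raddf0 lexx.
  by rewrite ltW // H // mem_filter v0 mem_cat vvs.
have Nv0 : 0 < - v.
  by have /lex_ltE[a va h] := v0; apply/lex_ltE; exists a => [|b /h];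
    rewrite !lexpowN !lexpow0 in va *; [rewrite oppr_gt0|move->; rewrite oppr0].
have : 0 < phi (- v) by apply: H; rewrite mem_filter Nv0 mem_cat map_f ?orbT.
by rewrite raddfN oppr_gt0 => /lt_geF.
Qed.

Lemma lex_sub_ge0 (u v : Lam) : (0 <= v - u) = (u <= v).
Proof.
apply/idP/idP => h.
  by have := lex_le_transl u h; rewrite add0r subrK.
by have := lex_le_transl (- u) h; rewrite subrr.
Qed.

Lemma lex_eq_le (u v : Lam) : u = v -> u <= v.
Proof. by move->. Qed.

(* Flag [false] marks a negated inequality. *)
Fixpoint refuted (le : Lam * Lam -> bool) (ps : seq (bool * (Lam * Lam))) : Prop :=
  if ps is (b, p) :: ps' then (if b then le p else ~~ le p) -> refuted le ps' else False.

(** The pairs matter only through the signs of their differences, which a single functional reflects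
    for the whole list, so a contradiction over the reals carries over. *)
Lemma lex_refute (ps : seq (bool * (Lam * Lam))) :
  (forall phi : Lam -> R, {morph phi : u v / u + v} -> {morph phi : u / - u} ->
     phi 0 = 0 -> refuted (fun p => phi p.1 <= phi p.2) ps) ->
  refuted (fun p => p.1 <= p.2) ps.
Proof.
have [phi H] := lex_sign_functional [seq x.2.2 - x.2.1 | x <- ps].
move=> /(_ phi (raddfD _) (raddfN _) (raddf0 _)).
elim: ps H => //= -[b p] ps IH H /= hp pb; apply: IH.
  by move=> v vps; apply: H; rewrite inE vps orbT.
by apply: hp; rewrite -subr_ge0 -raddfB H ?mem_head // lex_sub_ge0.
Qed.

End LexFunctional.

Ltac lex_lra :=
  intros;
  repeat match goal with
  | H : is_true (~~ @Order.le _ _ _ _) |- _ => rewrite -ltNge in H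
  end; lra.

(** Each pair is consed when its hypothesis is reverted, so [acc] lists the premises of the goal
    from the outside in, as [refuted] expects. *)
Ltac lex_to_reals acc :=
  lazymatch goal with
  | H : is_true (@Order.le _ _ ?x ?y) |- _ =>
      let p := constr:((true, (x, y)) : bool * (lexpow _ _ * lexpow _ _)) in
      revert H; lex_to_reals constr:(p :: acc)
  | H : is_true (~~ @Order.le _ _ ?x ?y) |- _ =>
      let p := constr:((false, (x, y)) : bool * (lexpow _ _ * lexpow _ _)) in
      revert H; lex_to_reals constr:(p :: acc)
  | |- _ =>
      refine (@lex_refute _ _ _ acc _);
      let phi := fresh "phi" in
      let phiD := fresh "phiD" in
      let phiN := fresh "phiN" in
      let phi0 := fresh "phi0" in
      intros phi phiD phiN phi0;
      cbv beta iota delta [refuted fst snd];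
      rewrite ?(phiD, phiN, phi0); clear phiD phiN phi0;
      repeat match goal with
      | H : is_true _ |- _ => clear H
      | H : @eq _ _ _ |- _ => clear H
      | H : _ \/ _ |- _ => clear H
      end;
      (* Generalizing first keeps [lra] from comparing the atoms up to conversion. *)
      first
        [ repeat match goal with
          | |- context [phi ?t] => let r := fresh "r" in generalize (phi t); intro r
          end; lex_lra
        | lex_lra ]
  end.

(* The finitely many elements of [lexpow A R] involved are compared along an
   additive functional to [R] that reflects their order. *)
Ltac lexlra :=
  intros;
  try match goal with
  | |- @eq (lexpow _ _) _ _ => apply/le_anti/andP; split
  | |- @eq _ _ _ => apply/le_anti/andP; split
  end;
  try match goal with
  | |- is_true (@Order.le _ _ ?x ?y) => rewrite leNgt; apply/negP => ?
  | |- is_true (@Order.lt _ _ ?x ?y) => rewrite ltNge; apply/negP => ?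
  end;
  repeat match goal with
  | H : is_true (@Order.lt _ _ _ _) |- _ => rewrite ltNge in H
  | H : is_true (_ && _) |- _ => case/andP: H => ? ?
  | H : ?x = ?y |- _ =>
     let p := constr:((x, y) : lexpow _ _ * lexpow _ _) in
     let H1 := fresh in let H2 := fresh in
     have H1 := lex_eq_le H; have H2 := lex_eq_le (esym H); clear H
  end;
  exfalso;
  match goal with
  | H : is_true (~~ @Order.le _ _ ?x ?y) |- _ =>
      let p := constr:((true, (x, y)) : bool * (lexpow _ _ * lexpow _ _)) in
      let T := type of p in lex_to_reals constr:(@nil T)
  | H : is_true (@Order.le _ _ ?x ?y) |- _ =>
      let p := constr:((true, (x, y)) : bool * (lexpow _ _ * lexpow _ _)) in
      let T := type of p in lex_to_reals constr:(@nil T)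
  end.

Ltac lexcase :=
  repeat match goal with
  | |- context [@Order.max _ _ ?x ?y] => case: (leP x y) => ?
  | |- context [@Order.min _ _ ?x ?y] => case: (leP x y) => ?
  end.

(* The context is dropped for speed. *)
Ltac lexgo :=
  repeat match goal with
  | H : is_true _ |- _ => clear H
  | H : @eq _ _ _ |- _ => clear H
  | H : _ \/ _ |- _ => clear H
  end; lexlra.

(** * Geodesic 0-hyperbolic spaces are trees *)

Section HyperbolicTree.
Context (d : Order.disp_t) (A : wellOrderType d) (R : realType).
Local Notation Lam := (lexpow A R).
Variables (T : Type) (D : T -> T -> Lam).
Hypothesis metricD : is_metric setT D.
Hypothesis four_point : forall x y z w,
  D x y + D z w <= Order.max (D x z + D y w) (D x w + D y z).
Hypothesis geodesicD : geodesic setT D.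
Hypothesis gromov_even : forall x y z, exists m : Lam, m + m = D x y + D x z - D y z.

Let D0 x y : 0 <= D x y. Proof. exact: (dist_ge0 metricD). Qed.
Let Dxx x : D x x = 0. Proof. exact/(dist_eq0 metricD). Qed.
Let Deq x y : D x y = 0 -> x = y. Proof. by move/(dist_eq0 metricD); apply. Qed.
Let DC x y : D x y = D y x. Proof. exact: (dist_sym metricD). Qed.
Let Dtri x y z : D x z <= D x y + D y z. Proof. exact: (dist_triangle metricD). Qed.

(** In a geodesic 0-hyperbolic space this is the only segment from [x] to [y], so segments can be
    handled by equations between distances. *)
Definition interval x y : set T := [set r | D x r + D r y = D x y].

Lemma intervalC x y : interval x y = interval y x.
Proof.
apply/seteqP; split=> r; rewrite /interval /=.
  by rewrite (DC x r) (DC r y) (DC x y); lexlra.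
by rewrite (DC x r) (DC r y) (DC x y); lexlra.
Qed.

Lemma absv_ge (u : Lam) : 0 <= u -> absv u = u.
Proof. by rewrite /absv => h; lexcase; lexlra. Qed.

Lemma absv_le (u : Lam) : u <= 0 -> absv u = - u.
Proof. by rewrite /absv => h; lexcase; lexlra. Qed.

(** In the four-point condition for [r], [s], [x], [y] both sums on the right equal [D x y], which
    leaves [D r s <= 0]. *)
Lemma interval_eq_dist x y r s : interval x y r -> interval x y s ->
  D x r = D x s -> r = s.
Proof.
rewrite /interval /= => rI sI e; apply: Deq; have := four_point r s x y.
rewrite (DC r x) (DC s x); have := D0 r s.
lexcase; lexlra.
Qed.

Lemma segment_interval S x y : segment_between setT D S x y -> S = interval x y.
Proof.
move=> [a [b [f [ab _ df -> [fa fb]]]]].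
have D1 s : a <= s <= b -> D x (f s) = s - a.
  move=> /andP[s1 s2]; rewrite -fa df ?lexx ?ab ?s1 ?s2 //.
  by rewrite absv_le; lexlra.
have D2 s : a <= s <= b -> D (f s) y = b - s.
  move=> /andP[s1 s2]; rewrite -fb df ?lexx ?ab ?s1 ?s2 //.
  by rewrite absv_le; lexlra.
have Dxy : D x y = b - a by rewrite -fb D1 // lexx ab.
apply/seteqP; split=> [_ [s /= sab <-]|r rI].
  by rewrite /interval /= D1 // D2 // Dxy; lexlra.
have sab : a <= a + D x r <= b.
  by move: rI (D0 x r) (D0 r y); rewrite /interval /= Dxy => rI h1 h2; apply/andP; split; lexlra.
exists (a + D x r) => //=; apply: (@interval_eq_dist x y) => //.
  by rewrite /interval /= D1 // D2 // Dxy; lexlra.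
by rewrite D1 //; lexlra.
Qed.

Lemma interval_segment x y : segment_between setT D (interval x y) x y.
Proof. by have [//|//|S sS] := @geodesicD x y; rewrite -(segment_interval sS). Qed.

Lemma endpoint_interval S x : endpoint setT D S x -> exists y, S = interval x y.
Proof.
move=> [y [/segment_interval ->|/segment_interval ->]]; exists y => //.
exact: intervalC.
Qed.

Lemma interval_dist x y r s : interval x y r -> interval x y s ->
  D x r <= D x s -> D x r + D r s = D x s.
Proof.
have [a [b [f [ab _ df -> [fa fb]]]]] := interval_segment x y.
move=> [s1 /= /andP[a1 b1] <-] [s2 /= /andP[a2 b2] <-].
rewrite -fa !df ?lexx ?ab ?a1 ?b1 ?a2 ?b2 // !(@absv_le (a - _)); try lexlra.
by move=> h; rewrite absv_le; lexlra.
Qed.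

(** Take the point of the segment from [x] to [y] whose distance from [x] is the Gromov product; the
    four-point condition puts it on the segment from [x] to [z] too. *)
Lemma median_exists x y z : exists m, [/\ interval x y m, interval x z m
  & D x m + D x m = D x y + D x z - D y z].
Proof.
have [m Em] := gromov_even x y z.
have [a [b [f [ab _ df fI [fa fb]]]]] := interval_segment x y.
have Dxy : D x y = b - a by rewrite -fa -fb df ?lexx ?ab // absv_le; lexlra.
have t1 := Dtri x y z; have t2 := Dtri x z y; have t3 := Dtri y x z.
rewrite (DC z y) in t2; rewrite (DC y x) in t3.
have m0 : 0 <= m by lexlra.
have mb : a + m <= b by lexlra.
have am : a <= a + m by lexlra.
have Dm : D x (f (a + m)) = m.
  by rewrite -fa df ?lexx ?ab ?mb ?am // absv_le; lexlra.
have Iy : interval x y (f (a + m)) by rewrite fI; exists (a + m) => //=; rewrite am.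
exists (f (a + m)); split; rewrite ?Dm //.
have := four_point (f (a + m)) z x y; move: Iy; rewrite /interval /= (DC _ x) Dm.
rewrite (DC z x) (DC z y) => Iy; have := Dtri x (f (a + m)) z; rewrite Dm.
lexcase; lexlra.
Qed.

Lemma interval_cat x y z : D y z = D y x + D x z ->
  interval x y `|` interval x z = interval y z.
Proof.
move=> e; apply/seteqP; split=> [r [|]|r]; rewrite /interval /=.
- by move=> h; have := Dtri y r z; have := Dtri r x z; rewrite (DC y r) (DC r x) e (DC y x); lexlra.
- by move=> h; have := Dtri y r z; have := Dtri y x r; rewrite (DC y x) in e *; lexlra.
move=> h; have := four_point r x y z; have := Dtri r x y; have := Dtri r x z.
have := Dtri x r y; have := Dtri x r z.
rewrite (DC r x) (DC r y) in h *; move: h e; rewrite (DC y x).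
by move=> h e h1 h2 h3 h4; rewrite le_max => /orP[h5|h5]; [right|left]; lexlra.
Qed.

(** Two segments from [x] meet exactly in the segment from [x] to the median. If they meet only in
    [x], the median is [x], the Gromov product vanishes and the distances add up. *)
Theorem hyperbolic_geodesic_tree : is_tree setT D.
Proof.
split=> // S1 S2 x /endpoint_interval[y ->] /endpoint_interval[z ->].
  move=> e; have [m [my mz Em]] := median_exists x y z.
  have mx : m = x by have : [set x] m by rewrite -e.
  rewrite mx Dxx in Em; exists y, z; rewrite interval_cat; last by rewrite (DC y x); lexlra.
  exact: interval_segment.
have [m [my mz Em]] := median_exists x y z.
exists x, m; suff -> : interval x y `&` interval x z = interval x m.
  exact: interval_segment.
apply/seteqP; split=> r.
  move=> [ry rz]; apply: (interval_dist ry my).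
  move: ry rz; rewrite /interval /= => ry rz.
  by have := Dtri y r z; rewrite (DC y r); lexlra.
rewrite /interval /= in my mz *; move=> rm.
have h1 := Dtri r m y; have h2 := Dtri r m z.
by have h3 := Dtri x r y; have h4 := Dtri x r z; split; lexlra.
Qed.

End HyperbolicTree.

(** * The tree of a Gromov product *)

Section PointTree.
Context (d : Order.disp_t) (A : wellOrderType d) (R : realType).
Local Notation Lam := (lexpow A R).

Lemma absv_leP (u r : Lam) : u <= r -> - u <= r -> absv u <= r.
Proof. by rewrite /absv => h1 h2; lexcase. Qed.

Lemma ler_absv (u : Lam) : u <= absv u.
Proof. by rewrite /absv; lexcase => //; lexlra. Qed.

Lemma absvN (u : Lam) : absv (- u) = absv u.
Proof. by rewrite /absv opprK; case: (leP u (- u)); case: (leP (- u) u); lexlra. Qed.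

(** Each disjunction is an ultrametric inequality with its minimum split into cases. The lemma leads
    from Gromov products at one base point to the four-point condition, which mentions no base
    point. *)
Lemma four_point_ultrametric (xy zw xz yw xw yz : Lam) :
  xz <= xy \/ yz <= xy -> xw <= xy \/ yw <= xy ->
  xz <= zw \/ xw <= zw -> yz <= zw \/ yw <= zw ->
  xz + yw <= xy + zw \/ xw + yz <= xy + zw.
Proof.
move=> h1 h2 h3 h4.
have [m1|m1] := leP xz yw; have [m2|m2] := leP xw yz.
- have [m3|m3] := leP yw yz; [left|right].
    by case: h1 => ?; case: h4 => ?; lexlra.
  by case: h2 => ?; case: h4 => ?; lexlra.
- have [m3|m3] := leP yw xw; [left|right].
    by case: h2 => ?; case: h3 => ?; lexlra.
  by case: h2 => ?; case: h4 => ?; lexlra.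
- have [m3|m3] := leP xz yz; [left|right].
    by case: h1 => ?; case: h4 => ?; lexlra.
  by case: h1 => ?; case: h3 => ?; lexlra.
- have [m3|m3] := leP xz xw; [left|right].
    by case: h2 => ?; case: h3 => ?; lexlra.
  by case: h1 => ?; case: h3 => ?; lexlra.
Qed.

(* [c] is the Gromov product and [h] the distance with respect to a base point
   [o] of a 0-hyperbolic space. *)
Record rooted_gromov (X : Type) (o : X) (h : X -> Lam) (c : X -> X -> Lam) : Prop :=
  RootedGromov {
    gromov_ge0 : forall x y, 0 <= c x y;
    gromovC : forall x y, c x y = c y x;
    gromovxx : forall x, c x x = h x;
    gromov_le : forall x y, c x y <= h x;
    gromov_ultra : forall x y z, Order.min (c x y) (c y z) <= c x z;
    gromov_root : h o = 0
  }.

Variables (X : Type) (o : X) (h : X -> Lam) (c : X -> X -> Lam).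
Hypothesis hc : rooted_gromov o h c.

Let c_ge0 := gromov_ge0 hc.
Let cC := gromovC hc.
Let cxx := gromovxx hc.
Let c_le := gromov_le hc.
Let c_ultra := gromov_ultra hc.

Let co x : c o x = 0. Proof. by apply/le_anti; rewrite c_ge0 -(gromov_root hc) c_le. Qed.

(** The height at which the paths from [o] to two tree points separate, that is, the Gromov product
    of these points at [o]. *)
Definition common x m y n : Lam := Order.min (Order.min m n) (c x y).

(* The function [z |-> dist(z, P)], where [P] is the point at distance [m] from
   [o] on the segment from [o] to [x]. *)
Definition point_fun x (m : Lam) : X -> Lam := fun z =>
  h z + m - (Order.min m (c x z) + Order.min m (c x z)).

(** The lexicographic group need not be order complete, so the supremum is asked to be attained.
    Between tree points it always is ([tree_dist_attained]), and the default 0 of [sup_dist] does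
    not occur there. *)
Definition attained_sup (p q : X -> Lam) (r : Lam) : Prop :=
  (forall z, absv (p z - q z) <= r) /\ exists z, absv (p z - q z) = r.

Lemma attained_sup_unique p q r s : attained_sup p q r -> attained_sup p q s -> r = s.
Proof.
by move=> [r1 [z rE]] [s1 [w sE]]; apply/le_anti; rewrite -{1}rE s1 -sE r1.
Qed.

Definition sup_dist p q : Lam := xget 0 [set r | attained_sup p q r].

Lemma sup_distE p q r : attained_sup p q r -> sup_dist p q = r.
Proof.
move=> pqr; rewrite /sup_dist; case: xgetP => [s -> /attained_sup_unique|/(_ r)]; exact.
Qed.

Lemma commonC x m y n : common x m y n = common y n x m.
Proof. by rewrite /common cC [Order.min m n]minC. Qed.

Lemma common_lel x m y n : common x m y n <= m.
Proof. by rewrite /common !ge_min lexx. Qed.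

Lemma common_ler x m y n : common x m y n <= n.
Proof. by rewrite /common !ge_min lexx orbT. Qed.

Lemma commonxx x m : m <= h x -> common x m x m = m.
Proof. by move=> mh; rewrite /common minxx cxx min_l. Qed.

Lemma common_ultra x m y n z k :
  common x m y n <= common x m z k \/ common y n z k <= common x m z k.
Proof.
apply/orP; rewrite -ge_min; have := c_ultra x y z.
rewrite /common !le_min !ge_min !lexx /= ?orbT /=.
by move=> /orP[->|->]; rewrite ?orbT.
Qed.

(** With [z] read as the tree point at height [h z] on the way to [z], the value at [z] takes the
    form of a distance between two tree points. *)
Lemma point_fun_common x m z : m <= h x ->
  point_fun x m z = h z + m - (common x m z (h z) + common x m z (h z)).
Proof.
move=> mh; rewrite /point_fun /common -minA.
by rewrite [Order.min (h z) _]min_r // cC.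
Qed.

(** The bound is the triangle inequality, from [common_ultra]. It is attained at [o] if one point
    lies on the path from [o] to the other; otherwise at [x], since the path from the second point
    to [x] passes through the first. *)
Lemma point_dist_common x m y n : 0 <= m <= h x -> 0 <= n <= h y ->
  attained_sup (point_fun x m) (point_fun y n)
    (m + n - (common x m y n + common x m y n)).
Proof.
move=> /andP[m0 mh] /andP[n0 nh]; split=> [z|].
  rewrite !point_fun_common //.
  have := common_ultra x m y n z (h z); have := common_ultra y n x m z (h z).
  rewrite (commonC y n x m).
  have h1 := common_lel x m y n; have h2 := common_ler x m y n.
  have h3 := common_lel x m z (h z); have h4 := common_lel y n z (h z).
  move=> h5 h6.
  by apply: absv_leP; case: h5 => ?; case: h6 => ?; lexlra.
have po u k : 0 <= k -> point_fun u k o = k.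
  by move=> k0; rewrite /point_fun cC co (gromov_root hc) min_r //; lexlra.
have [mn|mn] := leP m n.
  have [mc|mc] := leP m (c x y).
    exists o; rewrite !po // /common (min_l mn) (min_l mc) absv_le; lexlra.
  exists x; rewrite /point_fun cxx (min_l mh) (cC y x) /common (min_l mn) (min_r (ltW mc)).
  rewrite min_r; last lexlra.
  by rewrite absv_le; lexlra.
have [mc|mc] := leP n (c x y).
  by exists o; rewrite !po // /common (min_r (ltW mn)) (min_l mc) absv_ge; lexlra.
exists x; rewrite /point_fun cxx (min_l mh) (cC y x) /common (min_r (ltW mn)) (min_r (ltW mc)).
by rewrite absv_le; lexlra.
Qed.

Definition is_point (p : X -> Lam) : Prop :=
  exists x m, 0 <= m <= h x /\ p = point_fun x m.

Definition tree_point : Type := {p : X -> Lam | is_point p}.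

Definition tree_dist (P Q : tree_point) : Lam := sup_dist (sval P) (sval Q).

Lemma tree_point_eq (P Q : tree_point) : sval P = sval Q -> P = Q.
Proof. by move=> e; apply: eq_sig_hprop => // ? ? ?; exact: Prop_irrelevance. Qed.

Lemma is_point_fun x m : 0 <= m <= h x -> is_point (point_fun x m).
Proof. by exists x, m. Qed.

Definition mk_point x m (hm : 0 <= m <= h x) : tree_point :=
  exist _ _ (is_point_fun hm).

Lemma tree_pointP (P : tree_point) : exists x m (hm : 0 <= m <= h x), P = mk_point hm.
Proof. by case: P => p [x [m [hm e]]]; exists x, m, hm; exact: tree_point_eq. Qed.

Lemma tree_distE x m y n (hm : 0 <= m <= h x) (hn : 0 <= n <= h y) :
  tree_dist (mk_point hm) (mk_point hn) = m + n - (common x m y n + common x m y n).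
Proof. exact/sup_distE/point_dist_common. Qed.

Lemma tree_dist_attained P Q : attained_sup (sval P) (sval Q) (tree_dist P Q).
Proof.
have [x [m [hm ->]]] := tree_pointP P; have [y [n [hn ->]]] := tree_pointP Q.
by rewrite tree_distE; exact: point_dist_common.
Qed.

Lemma tree_dist_metric : is_metric setT tree_dist.
Proof.
split=> [P Q _ _|P Q _ _|P Q _ _|P Q S _ _ _].
- have [x [m [hm ->]]] := tree_pointP P; have [y [n [hn ->]]] := tree_pointP Q.
  rewrite tree_distE; have := common_lel x m y n; have := common_ler x m y n; lexlra.
- split=> [e|->].
    apply: tree_point_eq; apply/funext => z.
    have [le _] := tree_dist_attained P Q; have := le z; rewrite e.
    have := ler_absv (sval P z - sval Q z); have := ler_absv (- (sval P z - sval Q z)).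
    by rewrite absvN; lexlra.
  have [y [n [hn ->]]] := tree_pointP Q; rewrite tree_distE commonxx; first lexlra.
  by case/andP: hn.
- have [x [m [hm ->]]] := tree_pointP P; have [y [n [hn ->]]] := tree_pointP Q.
  by rewrite !tree_distE commonC [m + n]addrC.
have [x [m [hm ->]]] := tree_pointP P; have [y [n [hn ->]]] := tree_pointP Q.
have [z [k [hk ->]]] := tree_pointP S.
rewrite !tree_distE; have := common_ultra x m y n z k.
have := common_ler x m y n; have := common_lel y n z k.
by move=> ? ? [?|?]; lexlra.
Qed.

Lemma tree_dist_four_point P Q S U :
  tree_dist P Q + tree_dist S U <=
  Order.max (tree_dist P S + tree_dist Q U) (tree_dist P U + tree_dist Q S).
Proof.
have [x [m [hm ->]]] := tree_pointP P; have [y [n [hn ->]]] := tree_pointP Q.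
have [z [k [hk ->]]] := tree_pointP S; have [w [l [hl ->]]] := tree_pointP U.
rewrite !tree_distE le_max.
have := @four_point_ultrametric (common x m y n) (common z k w l) (common x m z k)
  (common y n w l) (common x m w l) (common y n z k).
have h1 := common_ultra x m z k y n; rewrite (commonC z k y n) in h1.
have h2 := common_ultra x m w l y n; rewrite (commonC w l y n) in h2.
have h3 := common_ultra z k x m w l; rewrite (commonC z k x m) in h3.
have h4 := common_ultra z k y n w l; rewrite (commonC z k y n) in h4.
move=> /(_ h1 h2 h3 h4) {h1 h2 h3 h4}.
by move=> [?|?]; apply/orP; [left|right]; lexlra.
Qed.

Lemma tree_dist_even P Q S :
  exists m : Lam, m + m = tree_dist P Q + tree_dist P S - tree_dist Q S.
Proof.
have [x [m [hm ->]]] := tree_pointP P; have [y [n [hn ->]]] := tree_pointP Q.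
have [z [k [hk ->]]] := tree_pointP S; rewrite !tree_distE.
exists (m - common x m y n - common x m z k + common y n z k); lexlra.
Qed.

Lemma tree_dist_geodesic : geodesic setT tree_dist.
Proof.
move=> P Q _ _; have [x [m [hm ->]]] := tree_pointP P.
have [y [n [hn ->]]] := tree_pointP Q; have /andP[m0 mh] := hm; have /andP[n0 nh] := hn.
(* [k] is the height of the branching point. The segment is parametrized by a signed distance [s]
   from it: [s <= 0] is the point at height [k - s] towards [x], [s >= 0] the point at height
   [k + s] towards [y]. *)
have [k kE] : exists k, k = common x m y n by exists (common x m y n).
have km : k <= m by rewrite kE common_lel.
have kn : k <= n by rewrite kE common_ler.
have k0 : 0 <= k by rewrite kE /common !le_min m0 n0 c_ge0.
have Hx s : k - m <= s <= n - k -> s <= 0 -> 0 <= k - s <= h x.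
  by move=> ? ?; apply/andP; split; lexlra.
have Hy s : k - m <= s <= n - k -> 0 <= s -> 0 <= k + s <= h y.
  by move=> ? ?; apply/andP; split; lexlra.
(* If [k] is [m] or [n], one branch is a single point; otherwise [k = c x y] bounds the common
   height of points on opposite branches. *)
have kcase : [\/ k = m, k = n | k = c x y].
  rewrite kE /common; have [_|_] := leP m n; case: (leP _ (c x y)) => _;
  by [apply: Or31|apply: Or32|apply: Or33].
have agree : point_fun x k = point_fun y k.
  have kc : k <= c x y by rewrite kE /common ge_min lexx orbT.
  have le u v z : k <= c u v -> Order.min k (c u z) <= Order.min k (c v z).
    move=> kuv; rewrite le_min ge_min lexx /=; apply: le_trans (c_ultra v u z).
    by rewrite le_min !ge_min lexx orbT andbT (cC v u) kuv.
  apply/funext => z; rewrite /point_fun.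
  suff -> : Order.min k (c x z) = Order.min k (c y z) by [].
  by apply/le_anti; rewrite !le // cC.
(* Both clauses apply at [s = 0], where [agree] reconciles them; off the interval [P] is a dummy
   value. *)
have /choice[f Hf] : forall s, exists p : tree_point,
    (k - m <= s <= n - k -> s <= 0 -> sval p = point_fun x (k - s)) /\
    (k - m <= s <= n - k -> 0 <= s -> sval p = point_fun y (k + s)).
  move=> s; have [s1|s1] := pselect (k - m <= s <= n - k); last by exists P; split.
  have [s0|/ltW s0] := leP s 0.
    exists (mk_point (Hx s s1 s0)); split=> // _ s2.
    rewrite /=; have -> : s = 0 by apply/le_anti; rewrite s0 s2.
    by rewrite subr0 addr0.
  by exists (mk_point (Hy s s1 s0)).
have fx (s : Lam) := (Hf s).1; have fy (s : Lam) := (Hf s).2.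
have same u v w a b : 0 <= a <= h u -> 0 <= b <= h u -> sval v = point_fun u a ->
    sval w = point_fun u b -> tree_dist v w = absv (a - b).
  move=> a1 b1 e1 e2; rewrite /tree_dist e1 e2 (sup_distE (point_dist_common a1 b1)).
  move: a1 b1 => /andP[_ a1] /andP[_ b1]; rewrite /common cxx.
  have [ab|/ltW ba] := leP a b.
    by rewrite min_l // absv_le; [lexgo|move: ab; lexgo].
  by rewrite min_l // absv_ge; [lexgo|move: ba; lexgo].
have opp (s t : Lam) : k - m <= s <= n - k -> k - m <= t <= n - k -> s <= 0 -> 0 <= t ->
    tree_dist (f s) (f t) = absv (s - t).
  move=> s1 t1 s0 t0; rewrite /tree_dist fx // fy // (sup_distE (point_dist_common _ _)).
    rewrite absv_le; last by move: s0 t0; lexgo.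
    suff -> : common x (k - s) y (k + t) = k by lexgo.
    have kc : k <= c x y by rewrite kE /common ge_min lexx orbT.
    apply/le_anti; rewrite /common !le_min !ge_min kc -!andbA; apply/and4P.
    split=> //; try by [move: s0; lexgo|move: t0; lexgo].
    rewrite -orbA; apply/or3P; case: kcase => kk.
    - by apply: Or31; case/andP: s1; move: kk; lexgo.
    - by apply: Or32; case/andP: t1; move: kk; lexgo.
    - by apply: Or33; rewrite kk.
  exact: Hx. exact: Hy.
have Dsym := dist_sym tree_dist_metric.
exists (f @` [set s | k - m <= s <= n - k]); exists (k - m), (n - k), f; split=> //.
- by move: km kn; lexgo.
- move=> s t s1 t1; have [s0|/ltW s0] := leP s 0; have [t0|/ltW t0] := leP t 0.
  + rewrite (same x _ _ _ _ (Hx s s1 s0) (Hx t t1 t0) (fx s s1 s0) (fx t t1 t0)).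
    by rewrite -absvN; congr absv; lexgo.
  + exact: opp.
  + by rewrite Dsym // opp // -absvN opprB.
  + rewrite (same y _ _ _ _ (Hy s s1 s0) (Hy t t1 t0) (fy s s1 s0) (fy t t1 t0)).
    by congr absv; lexgo.
- split; apply: tree_point_eq => /=.
    rewrite fx; first by congr point_fun; lexgo.
      by rewrite lexx /=; move: km kn; lexgo.
    by move: km; lexgo.
  rewrite fy; first by congr point_fun; lexgo.
    by rewrite lexx andbT; move: km kn; lexgo.
  by move: kn; lexgo.
Qed.

Theorem tree_point_tree : is_tree setT tree_dist.
Proof.
apply: hyperbolic_geodesic_tree.
- exact: tree_dist_metric.
- exact: tree_dist_four_point.
- exact: tree_dist_geodesic.
- exact: tree_dist_even.
Qed.

(** The two terms are the distance from [z] to [o] less [m], and the distance from [z] to [x] less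
    [h x - m]: the point is described by its distances to both ends of the segment. *)
Lemma point_funE x m z :
  point_fun x m z = Order.max (h z - m) (h z + m - (c x z + c x z)).
Proof. by rewrite /point_fun; lexcase; lexlra. Qed.

Let dX x y : Lam := h x + h y - (c x y + c x y).

(* The point at distance [m] from [x] on the segment from [x] to [y]. *)
Lemma is_point_between x y (m : Lam) : 0 <= m <= dX x y ->
  is_point (fun z => Order.max (dX z x - m) (dX z y - (dX x y - m))).
Proof.
(* Seen from a point at height [k >= c u v] on the way to [u], the root and [v] lie in the same
   direction, so [v] may replace the root in the maximum. *)
have key u v k z : c u v <= k ->
    Order.max (h z - k) (h z + k - (c u z + c u z)) =
    Order.max (h z + k - (c u z + c u z)) (h z - k + (c u v + c u v) - (c v z + c v z)).
  move=> uvk; have [uzk|kuz] := leP (c u z) k.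
    rewrite max_r; last lexlra.
    rewrite max_l //; have := c_ultra v u z; rewrite (cC v u) ge_min.
    by case/orP => ?; lexlra.
  have -> : c v z = c u v.
    apply/le_anti/andP; split.
      have := c_ultra u z v; rewrite (cC z v) ge_min => /orP[?|//]; lexlra.
    by have := c_ultra v u z; rewrite (cC v u) ge_min => /orP[//|?]; lexlra.
  by rewrite max_l ?max_r; lexlra.
move=> /andP[m0 mD].
(* Up to [h x - c x y] the point is still on the branch of [x]; beyond that it is on the branch of
   [y]. *)
have [mk|mk] := leP m (h x - c x y).
  exists x, (h x - m); have := c_le x y; have := c_ge0 x y => c0 ch.
  split; first by apply/andP; split; lexlra.
  apply/funext => z; rewrite point_funE (key x y); last lexlra.
  rewrite /dX (cC z x) (cC z y).
  congr Order.max; lexgo.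
exists y, (h y - (dX x y - m)); rewrite /dX in mD *.
have := c_le y x; have := c_ge0 x y; rewrite (cC y x) => c0 ch.
split; first by apply/andP; split; lexlra.
apply/funext => z; rewrite point_funE (key y x); last by rewrite cC; lexlra.
rewrite /dX (cC z x) (cC z y) (cC y x) maxC.
congr Order.max; lexgo.
Qed.

End PointTree.

(** * Cancellations as matchings *)

Section Matching.
Variable A : Type.
Implicit Types (w v u : word A).

Lemma wle_refl w (s : dom w) : wle s s.
Proof. by have /orP[] := wle_total s s. Qed.

Lemma betweenP w (s t r : dom w) :
  between s t r <-> (wle s r /\ wle r t) \/ (wle t r /\ wle r s).
Proof.
by split=> [/orP[/andP|/andP]|[/andP h|/andP h]]; [left|right| |];
  rewrite // /between /= h ?orbT.
Qed.

Lemma betweenC w (s t : dom w) : between s t = between t s.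
Proof. by apply/seteqP; split=> r; rewrite /between /= orbC. Qed.

Lemma between_l w (s t : dom w) : between s t s.
Proof.
rewrite /between /= !wle_refl /= andbT.
by case/orP: (wle_total s t) => ->; rewrite ?orbT.
Qed.

Lemma between_r w (s t : dom w) : between s t t.
Proof. by rewrite betweenC; exact: between_l. Qed.

Definition convex w (C : set (dom w)) : Prop :=
  forall s t r, C s -> C t -> between s t r -> C r.

Lemma convexP w (C : set (dom w)) :
  (forall s t r, C s -> C t -> wle s r -> wle r t -> C r) -> convex C.
Proof. by move=> h s t r Cs Ct /betweenP[[sr rt]|[tr rs]]; [exact: h sr rt|exact: h tr rs]. Qed.

Lemma between_exchange w (s t r r' : dom w) :
  between s t r -> ~ between s t r' -> between r r' s \/ between r r' t.
Proof.
have aux (p q : dom w) : wle p r /\ wle r q -> ~ between p q r' ->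
    between r r' p \/ between r r' q.
  move=> [pr rq] h.
  case/orP: (wle_total p r') => pr'; last by left; apply/betweenP; right.
  case/orP: (wle_total r' q) => r'q; last by right; apply/betweenP; left.
  by exfalso; apply: h; apply/betweenP; left.
by move=> /betweenP[/aux//|/aux]; rewrite betweenC => h /h[]; [right|left].
Qed.

(* The graph of the involution of a cancellation. *)
Record matching w (M : set (dom w * dom w)) : Prop := Matching {
  matching_sym : forall s t, M (s, t) -> M (t, s);
  matching_fun : forall s t t', M (s, t) -> M (s, t') -> t = t';
  matching_letter : forall s t, M (s, t) -> letter t = sinv (letter s);
  matching_between : forall s t r, M (s, t) -> between s t r ->
    exists2 r', M (r, r') & between s t r'
}.

Definition matched w (M : set (dom w * dom w)) : set (dom w) :=
  [set s | exists t, M (s, t)].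

(** A relation carries no values off the cancelled part, unlike the map [star], so it can be
    restricted, extended and united along chains. *)
Lemma matching_cancellation w (M : set (dom w * dom w)) :
  matching M -> cancellation (matched M).
Proof.
move=> [sym fn lt btw].
have /choice[star starM] : forall s, exists t, matched M s -> M (s, t).
  by move=> s; have [[t st]|ns] := pselect (matched M s); [exists t|exists s].
have starP s t : M (s, t) -> star s = t.
  by move=> st; have h := starM s (ex_intro _ t st); exact: fn h st.
exists star; split=> s [t st].
- by rewrite (starP _ _ st); exists s; exact: sym.
- by rewrite (starP _ _ st) (starP t s) //; exact: sym.
- by rewrite (starP _ _ st) => r /(btw _ _ _ st)[r' rr' _]; exists r'.
- rewrite (starP _ _ st); apply/seteqP; split.
    by move=> _ [r /(btw _ _ _ st)[r' rr' b] <-]; rewrite (starP _ _ rr').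
  move=> r /(btw _ _ _ st)[r' rr' b]; exists r' => //.
  by rewrite (starP r' r) //; exact: sym.
- by rewrite (starP _ _ st); exact: lt.
Qed.

Lemma cancellation_matching w (T : set (dom w)) : cancellation T ->
  exists2 M : set (dom w * dom w), matching M & matched M = T.
Proof.
move=> [star [sT ss sb sbb sl]].
exists [set p | T p.1 /\ p.2 = star p.1]; last first.
  by apply/seteqP; split=> [s [t []//]|s Ts]; exists (star s).
split=> /=.
- by move=> s t [Ts ->]; split; [exact: sT|rewrite ss].
- by move=> s t t' [_ ->] [_ ->].
- by move=> s t [Ts ->]; exact: sl.
- move=> s t r [Ts ->] b; exists (star r); first by split=> //; exact: sb b.
  by rewrite -sbb //; exists r.
Qed.

Lemma reducedP w : reduced w <-> forall M : set (dom w * dom w), matching M -> M = set0.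
Proof.
split=> [red M mM|red T /cancellation_matching[M /red -> <-]].
  apply/seteqP; split=> // -[s t] st.
  by have : matched M s; [exists t|rewrite (red _ (matching_cancellation mM))].
by apply/seteqP; split=> // s [].
Qed.

Lemma matching_sub w (M : set (dom w * dom w)) (C : set (dom w)) :
  matching M -> convex C -> matching [set p | [/\ M p, C p.1 & C p.2]].
Proof.
move=> [sym fn lt btw] cC; split=> /=.
- by move=> s t [st Cs Ct]; split=> //; exact: sym.
- by move=> s t t' [st _ _] [st' _ _]; exact: fn st st'.
- by move=> s t [/lt].
- move=> s t r [st Cs Ct] b; have [r' rr' b'] := btw _ _ _ st b; exists r' => //.
  by split=> //=; [exact: cC b|exact: cC b'].
Qed.

(** * Transport of matchings along order embeddings *)

Section Embedding.
Variables (w v : word A) (phi : dom v -> dom w).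
Hypothesis phi_mono : {mono phi : s t / wle s t}.
Hypothesis phi_letter : forall s, letter (phi s) = letter s.

Lemma mono_between s t r : between (phi s) (phi t) (phi r) <-> between s t r.
Proof. by rewrite /between /= !phi_mono. Qed.

Lemma mono_injective : injective phi.
Proof.
by move=> s t e; apply: wle_anti; rewrite -!phi_mono e wle_refl.
Qed.

Lemma matching_preimage (M : set (dom w * dom w)) :
    matching M -> (forall s t, M (phi s, t) -> exists t', phi t' = t) ->
  matching [set p | M (phi p.1, phi p.2)].
Proof.
move=> [sym fn lt btw] rg; split=> /=.
- by move=> s t /sym.
- by move=> s t t' st st'; apply: mono_injective; exact: fn st st'.
- by move=> s t /lt; rewrite !phi_letter.
- move=> s t r st b; have [|r' rr' b'] := btw _ _ (phi r) st; first exact/mono_between.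
  by have [r0 r0E] := rg _ _ rr'; exists r0; rewrite ?r0E //; apply/mono_between; rewrite r0E.
Qed.

(** Convexity keeps positions outside the range from entering the interval of a pair. *)
Lemma matching_image (N : set (dom v * dom v)) :
  matching N -> convex (range phi) ->
  matching [set (phi p.1, phi p.2) | p in N].
Proof.
move=> [sym fn lt btw] cv; split.
- by move=> _ _ [[s t] st [<- <-]]; exists (t, s) => //; exact: sym.
- move=> _ _ t' [[s t] st [<- <-]] [[s' t''] /= st'] [/mono_injective e <-].
  by rewrite e in st'; rewrite (fn _ _ _ st st').
- by move=> _ _ [[s t] st [<- <-]]; rewrite !phi_letter; exact: lt.
- move=> _ _ r [[s t] st [<- <-]] b /=.
  have [r0 _ r0E] : range phi r by apply: cv b; [exists s|exists t].
  rewrite -r0E in b *; move/mono_between in b.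
  have [r' rr' b'] := btw _ _ _ st b.
  by exists (phi r'); [exists (r0, r')|apply/mono_between].
Qed.

Lemma reduced_embedding : reduced w -> convex (range phi) -> reduced v.
Proof.
move=> /reducedP red cv; apply/reducedP => N mN.
have e := red _ (matching_image mN cv).
apply/seteqP; split=> // p Np.
have : [set (phi p.1, phi p.2) | p in N] (phi p.1, phi p.2) by exists p.
by rewrite e.
Qed.

End Embedding.

Lemma sval_mono w (P : set (dom w)) :
  {mono (fun s : dom (wrestrict P) => sval s : dom w) : s t / wle s t}.
Proof. by []. Qed.

Lemma reduced_restrict w (P : set (dom w)) : reduced w -> convex P -> reduced (wrestrict P).
Proof.
move=> red cP.
have rg : range (fun s : dom (wrestrict P) => sval s : dom w) = P.
  by apply/seteqP; split=> [_ [s _ <-]|s Ps]; [exact: svalP s|exists (exist _ s Ps)].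
by apply: (reduced_embedding (@sval_mono w P)) => //; rewrite rg.
Qed.

Lemma matching_winv w (M : set (dom w * dom w)) : @matching (winv w) M -> matching M.
Proof.
move=> [sym fn lt btw]; split=> //.
- by move=> s t /lt /= /(congr1 (@sinv A)); rewrite !sinvK.
- move=> s t r st b; have [|r' rr' /betweenP b'] := btw s t r st.
    by move/betweenP: b => b; apply/betweenP => /=; tauto.
  by exists r' => //; apply/betweenP => /=; simpl in b'; tauto.
Qed.

Lemma reduced_winv w : reduced w -> reduced (winv w).
Proof. by move=> /reducedP red; apply/reducedP => M /matching_winv/red. Qed.

(** The point is an [M]-matched [r] inside the interval of a pair of [N]. If its partner [r'] were
    outside, the interval from [r] to [r'] would contain an end of that pair, which would then be
    [M]-matched. *)
Lemma matching_extend w (M : set (dom w * dom w)) :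
  matching M -> forall N, @matching (wrestrict (~` matched M)) N ->
  matching (M `|` [set (sval p.1, sval p.2) | p in N]).
Proof.
move=> mM N mN; have [sym fn lt btw] := mM; have [sym' fn' lt' btw'] := mN.
have nsupp (s : dom (wrestrict (~` matched M))) t : ~ M (sval s, t).
  by move=> st; apply: (svalP s); exists t.
split.
- move=> s t [/sym|[[s' t'] st [<- <-]]]; [by left|right].
  by exists (t', s') => //; exact: sym'.
- move=> s t t' [st|[[s1 t1] st [/= es <-]]] [st'|[[s2 t2] st' [/= es' <-]]].
  + exact: fn st st'.
  + by exfalso; apply: (nsupp s2 t); rewrite es'.
  + by exfalso; apply: (nsupp s1 t'); rewrite es.
  + have e : s1 = s2.
      by apply: (mono_injective (@sval_mono w (~` matched M))); rewrite es es'.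
    by rewrite e in st; rewrite (fn' _ _ _ st st').
- by move=> s t [/lt//|[[s' t'] st [<- <-]]]; exact: (lt' _ _ st).
- move=> s t r [st|[[s' t'] st [<- <-]]] b.
    by have [r' rr' b'] := btw _ _ _ st b; exists r' => //; left.
  have [[r' rr']|nr] := pselect (matched M r).
    exists r'; first by left.
    apply: contrapT => /(between_exchange b)[] h.
      by have [t1 /nsupp] := btw _ _ _ rr' h.
    by have [t1 /nsupp] := btw _ _ _ rr' h.
  have [|r' rr' b'] := btw' _ _ (exist _ r nr) st; first exact: b.
  by exists (sval r') => //; right; exists (exist _ r nr, r').
Qed.

(** Zorn's lemma applies to unions of chains; a pair left in the remaining word would enlarge the
    maximal matching by [matching_extend]. *)
Lemma maximal_matching w : exists2 M : set (dom w * dom w), matching M &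
  reduced (wrestrict (~` matched M)).
Proof.
have [F FP Ft|M [mM maxM]] := @Zorn_bigcup _ (@matching w).
  split.
  - by move=> s t [M FM st]; exists M => //; exact: matching_sym (FP _ FM) _ _ st.
  - move=> s t t' [M FM st] [N FN st'].
    have [sub|sub] := Ft _ _ FM FN.
      exact: matching_fun (FP _ FN) _ _ _ (sub _ st) st'.
    exact: matching_fun (FP _ FM) _ _ _ st (sub _ st').
  - by move=> s t [M FM st]; exact: matching_letter (FP _ FM) _ _ st.
  - move=> s t r [M FM st] b.
    by have [r' rr' b'] := matching_between (FP _ FM) st b; exists r' => //; exists M.
exists M => //; apply/reducedP => N mN.
apply/seteqP; split=> // -[s t] st; exfalso.
apply: maxM (matching_extend mM mN); split; first by move=> p; left.
move=> /(_ (sval s, sval t)) h; apply: (svalP s); exists (sval t); apply: h.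
by right; exists (s, t).
Qed.

Lemma reduced_exists w : exists2 T : set (dom w), cancellation T & reduced (wrestrict (~` T)).
Proof.
by have [M /matching_cancellation cM red] := maximal_matching w; exists (matched M).
Qed.

End Matching.

(** * Reduction in free groups *)

Section FreeReduction.
Variable A : eqType.
Implicit Types (x y : sletter A) (s : seq (sletter A)).

Definition free_push x s : seq (sletter A) :=
  if s is y :: s' then if y == sinv x then s' else x :: s else [:: x].

Definition free_red s : seq (sletter A) := foldr free_push [::] s.

Definition irreducible : pred (seq (sletter A)) := sorted (fun x y => y != sinv x).

Lemma free_push_irreducible x s : irreducible s -> irreducible (free_push x s).
Proof.
case: s => //= y s ys; case: eqP => [_|/eqP n] /=; first exact: path_sorted ys.
by rewrite n.
Qed.

Lemma free_red_irreducible s : irreducible (free_red s).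
Proof. by elim: s => //= x s; exact: free_push_irreducible. Qed.

(** If [sinv x] removes a leading [x], irreducibility keeps the next letter from being [sinv x], so
    pushing [x] restores it. *)
Lemma free_pushK x s : irreducible s -> free_push x (free_push (sinv x) s) = s.
Proof.
case: s => [|y s] /=; first by rewrite eqxx.
rewrite sinvK; case: eqP => [->|_ _] /=; last by rewrite eqxx.
by case: s => [|z s] //= /andP[/negbTE-> _].
Qed.

Lemma free_red_cancel s1 x s2 : free_red (s1 ++ x :: sinv x :: s2) = free_red (s1 ++ s2).
Proof.
rewrite /free_red !foldr_cat /=; congr foldr; apply: free_pushK.
exact: free_red_irreducible.
Qed.

Lemma free_red_id s : irreducible s -> free_red s = s.
Proof.
elim: s => //= x s IH xs; rewrite IH; last exact: path_sorted xs.
by case: s xs {IH} => //= y s /andP[/negbTE->].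
Qed.

Lemma reducibleP s : ~~ irreducible s -> exists s1 x s2, s = s1 ++ x :: sinv x :: s2.
Proof.
elim: s => // x [|y s] IH //=; rewrite negb_and negbK => /orP[/eqP->|/IH].
  by exists [::], x, s.
by move=> [s1 [z [s2 ->]]]; exists (x :: s1), z, s2.
Qed.

Lemma free_red_nil s : free_red s = [::] -> s <> [::] ->
  exists s1 x s2, s = s1 ++ x :: sinv x :: s2 /\ free_red (s1 ++ s2) = [::].
Proof.
move=> red n0; have /reducibleP[s1 [x [s2 sE]]] : ~~ irreducible s.
  by apply/negP => /free_red_id e; apply: n0; rewrite -e.
by exists s1, x, s2; split=> //; rewrite -(free_red_cancel s1 x) -sE.
Qed.

End FreeReduction.

HB.instance Definition _ (A : Type) (w : word A) := gen_eqMixin (dom w).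

(** * Pairings on finite increasing sequences of positions *)

Section SortedSequences.
Variables (A : eqType) (w : word A).
Implicit Types (e : seq (dom w)).

Definition wsorted e : bool := uniq e && sorted (@wle _ w) e.

Lemma wsorted_cat2 e1 e2 e3 : wsorted (e1 ++ e2 ++ e3) -> wsorted (e1 ++ e3).
Proof.
move=> /andP[u s]; apply/andP; split.
  by move: u; rewrite uniq_catCA cat_uniq => /and3P[].
move: s; rewrite !sorted_pairwise; try exact: wle_trans.
by rewrite !pairwise_cat allrel_catr => /and3P[/andP[_ ->] -> /and3P[_ _ ->]].
Qed.

Lemma wsorted_le e1 e2 s t : wsorted (e1 ++ e2) -> s \in e1 -> t \in e2 ->
  wle s t /\ s <> t.
Proof.
move=> /andP[u srt] se te; split.
  move: srt; rewrite sorted_pairwise; last exact: wle_trans.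
  by rewrite pairwise_cat => /and3P[/allrelP h _ _]; exact: h.
move=> est; move: u; rewrite cat_uniq => /and3P[_ /hasPn/(_ _ te)].
by rewrite -est /= se.
Qed.

Lemma wsorted_adjacent e1 x y e2 r : wsorted (e1 ++ x :: y :: e2) ->
  r \in e1 ++ e2 -> [/\ r <> x, r <> y & (wle r x /\ wle r y) \/ (wle x r /\ wle y r)].
Proof.
move=> srt; rewrite mem_cat => /orP[re|re].
  have [rx nrx] := wsorted_le srt re (mem_head _ _).
  have [ry nry] : wle r y /\ r <> y.
    by apply: (wsorted_le srt re); rewrite !inE eqxx orbT.
  by split=> //; left.
have srt' : wsorted ((e1 ++ [:: x; y]) ++ e2) by rewrite -catA.
have [xr nxr] : wle x r /\ x <> r by apply: (wsorted_le srt'); rewrite ?mem_cat ?inE ?eqxx ?orbT.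
have [yr nyr] : wle y r /\ y <> r by apply: (wsorted_le srt'); rewrite ?mem_cat ?inE ?eqxx ?orbT.
by split; [exact/nesym|exact/nesym|right].
Qed.

(** Pair two neighbours [x], [y] with inverse letters and recurse on the rest. No entry lies
    strictly between neighbours, and an interval with ends elsewhere contains both or neither, so
    intervals stay stable. *)
Lemma finite_matching_exists e : wsorted e -> free_red (map (@letter _ w) e) = [::] ->
  exists star : dom w -> dom w, forall t, t \in e ->
    [/\ star t \in e, star (star t) = t, letter (star t) = sinv (letter t)
      & forall r, r \in e -> between t (star t) r -> between t (star t) (star r)].
Proof.
have [n] := ubnP (size e); elim: n e => // n IH e; rewrite ltnS => sz srt red.
have [e0|/eqP e0] := eqVneq e [::]; first by exists id => t; rewrite e0.
have [|s1 [a [s2 [eE red']]]] := free_red_nil red; first by case: (e) e0.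
have [e1 [x [y [e2 [eE2 e1E xa ya e2E]]]]] : exists e1 x y e2,
  [/\ e = e1 ++ x :: y :: e2, map (@letter _ w) e1 = s1, letter x = a,
    letter y = sinv a & map (@letter _ w) e2 = s2].
  clear -eE; elim: s1 e eE => [|b s1 IH] [|x e] //=.
    by case: e => // y e [xa ya e2E]; exists [::], x, y, e.
  move=> [xb /IH[e1 [x' [y' [e2 [-> e1E xa ya e2E]]]]]].
  by exists (x :: e1), x', y', e2; rewrite /= xb e1E.
subst e; have srt' : wsorted (e1 ++ e2) by exact: (@wsorted_cat2 e1 [:: x; y]).
have [|||star Hstar] := IH (e1 ++ e2).
- by apply: leq_trans sz; rewrite !size_cat /= !addnS ltnS leqnSn.
- by [].
- by rewrite map_cat e1E e2E.
have adj := wsorted_adjacent srt.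
have mem r : r \in e1 ++ x :: y :: e2 -> [\/ r = x, r = y | r \in e1 ++ e2].
  rewrite !mem_cat !inE => /or4P[h|/eqP->|/eqP->|h].
  - by apply: Or33; rewrite h.
  - exact: Or31.
  - exact: Or32.
  - by apply: Or33; rewrite h orbT.
have mem' r : r \in e1 ++ e2 -> r \in e1 ++ x :: y :: e2.
  by rewrite !mem_cat !inE => /orP[->//|->]; rewrite !orbT.
have nxy : x <> y.
  have srt2 : wsorted ((e1 ++ [:: x]) ++ y :: e2) by rewrite -catA.
  suff [] : wle x y /\ x <> y by [].
  by apply: (wsorted_le srt2); rewrite ?mem_cat ?inE ?eqxx ?orbT.
pose star' t := if t == x then y else if t == y then x else star t.
have starx : star' x = y by rewrite /star' eqxx.
have stary : star' y = x by rewrite /star' eqxx; case: eqP => // /esym.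
have starE t : t \in e1 ++ e2 -> star' t = star t.
  by move=> /adj[/eqP/negbTE tx /eqP/negbTE ty _]; rewrite /star' tx ty.
have xe : x \in e1 ++ x :: y :: e2 by rewrite mem_cat inE eqxx orbT.
have ye : y \in e1 ++ x :: y :: e2 by rewrite mem_cat !inE eqxx !orbT.
have noxy r : r \in e1 ++ e2 -> ~ between x y r.
  move=> /adj[nx ny [[rx ry]|[xr yr]]] /betweenP[[h1 h2]|[h1 h2]].
  - by apply: nx; apply: wle_anti; rewrite rx.
  - by apply: ny; apply: wle_anti; rewrite ry.
  - by apply: ny; apply: wle_anti; apply/andP.
  - by apply: nx; apply: wle_anti; apply/andP.
have side t t' p q : t \in e1 ++ e2 -> t' \in e1 ++ e2 ->
    (p = x /\ q = y) \/ (p = y /\ q = x) -> between t t' p -> between t t' q.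
  move=> /adj[tx ty ht] /adj[tx' ty' ht'] pq.
  move=> /betweenP[[h1 h2]|[h1 h2]]; apply/betweenP; [left|right].
  - by case: pq => -[? ?]; subst p q; case: ht => -[a1 a2]; case: ht' => -[b1 b2] //;
      exfalso; solve [apply: tx; apply: wle_anti; apply/andP; split=> //
        | apply: ty; apply: wle_anti; apply/andP; split=> //
        | apply: tx'; apply: wle_anti; apply/andP; split=> //
        | apply: ty'; apply: wle_anti; apply/andP; split=> //].
  - by case: pq => -[? ?]; subst p q; case: ht => -[a1 a2]; case: ht' => -[b1 b2] //;
      exfalso; solve [apply: tx; apply: wle_anti; apply/andP; split=> //
        | apply: ty; apply: wle_anti; apply/andP; split=> //
        | apply: tx'; apply: wle_anti; apply/andP; split=> //
        | apply: ty'; apply: wle_anti; apply/andP; split=> //].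
exists star' => t /mem[->|->|te].
- rewrite starx stary; split=> //; first by rewrite xa ya.
  move=> r /mem[->|->|/noxy h /h//] _; rewrite ?starx ?stary.
    exact: between_r.
  exact: between_l.
- rewrite stary starx; split=> //; first by rewrite xa ya sinvK.
  rewrite betweenC => r /mem[->|->|/noxy h /h//] _; rewrite ?starx ?stary.
    exact: between_r.
  exact: between_l.
have [ste sst lst bst] := Hstar t te; rewrite !starE //; split=> //; first exact: mem'.
move=> r /mem[->|->|re].
- by rewrite starx; apply: side => //; left.
- by rewrite stary; apply: side => //; right.
- by rewrite starE //; exact: bst.
Qed.

Variable M : set (dom w * dom w).
Hypothesis mM : matching M.

Lemma matching_neq s : ~ M (s, s).
Proof.
move=> /(matching_letter mM)/(congr1 (fun x : sletter A => x.2)) /=.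
by case: (letter s).2.
Qed.

(** The partner of the entry [r] following [s] again lies strictly between [s] and [t], so that pair
    encloses fewer entries; the descent stops at two neighbours. *)
Lemma adjacent_pair e1 s b t e2 : wsorted (e1 ++ s :: b ++ t :: e2) ->
    (forall p q, M (p, q) -> p \in e1 ++ s :: b ++ t :: e2 -> q \in e1 ++ s :: b ++ t :: e2) ->
    M (s, t) ->
  exists f1 x y f2, e1 ++ s :: b ++ t :: e2 = f1 ++ x :: y :: f2 /\ M (x, y).
Proof.
have [n] := ubnP (size b); elim: n e1 s b t e2 => // n IH e1 s b t e2.
rewrite ltnS => sz srt cl st.
case: b sz srt cl => [|r b] sz srt cl; first by exists e1, s, t, e2.
have srt1 : wsorted ((e1 ++ s :: r :: b) ++ t :: e2) by rewrite -catA.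
have srt2 : wsorted ((e1 ++ [:: s]) ++ (r :: b) ++ t :: e2) by rewrite -catA.
have srt3 : wsorted ((e1 ++ [:: s; r]) ++ b ++ t :: e2) by rewrite -catA.
have srt4 : wsorted ((e1 ++ (s :: r :: b) ++ [:: t]) ++ e2) by rewrite -!catA.
have ler : wle s r /\ s <> r by apply: (wsorted_le srt2); rewrite ?mem_cat ?inE ?eqxx ?orbT.
have rlet : wle r t /\ r <> t by apply: (wsorted_le srt1); rewrite ?mem_cat ?inE ?eqxx ?orbT.
have rb : between s t r.
  by apply/betweenP; left; split; [exact: ler.1|exact: rlet.1].
have [r' rr' rb'] := matching_between mM st rb.
have st' : wle s t := wle_trans ler.1 rlet.1.
have nr's : r' <> s.
  move=> e; have := matching_fun mM (matching_sym mM rr'); rewrite e => /(_ _ st) ert.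
  exact: rlet.2.
have nr't : r' <> t.
  move=> e; have := matching_fun mM (matching_sym mM rr'); rewrite e.
  move=> /(_ _ (matching_sym mM st)) ers.
  exact: ler.2.
have nr'r : r' <> r by move=> e; rewrite e in rr'; exact: matching_neq rr'.
have [sr' r't] : wle s r' /\ wle r' t.
  case/betweenP: rb' => -[h1 h2] //; split; last exact: wle_trans h2 st'.
  exact: wle_trans st' h1.
have r'e : r' \in b.
  have := cl _ _ rr'; rewrite !mem_cat !inE !mem_cat !inE !eqxx !orbT => /(_ isT).
  case/or4P; [|by move/eqP|by move/eqP|] => [h|/or3P[//|/eqP//|h]].
    have [h1 h2] := wsorted_le srt h (mem_head _ _).
    by exfalso; apply: h2; apply: wle_anti; rewrite h1.
  have [h1 h2] : wle t r' /\ t <> r'.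
    by apply: (wsorted_le srt4); rewrite ?mem_cat ?inE ?mem_cat ?inE ?eqxx ?orbT.
  by exfalso; apply: h2; apply: wle_anti; rewrite h1.
case/splitPr: r'e sz srt cl => b1 b2 sz srt cl.
have eE : e1 ++ s :: (r :: b1 ++ r' :: b2) ++ t :: e2 =
    (e1 ++ [:: s]) ++ r :: b1 ++ r' :: (b2 ++ t :: e2) by rewrite -!catA /= -catA.
rewrite eE in srt cl *; apply: IH => //.
by apply: leq_trans sz; rewrite /= size_cat ltnS leq_addr.
Qed.

Lemma free_red_matching e : wsorted e -> (forall p q, M (p, q) -> p \in e -> q \in e) ->
  free_red (map (@letter _ w) e) =
  free_red (map (@letter _ w) [seq s <- e | s \notin matched M]).
Proof.
have [n] := ubnP (size e); elim: n e => // n IH e; rewrite ltnS => sz srt cl.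
have [/hasP[s se /set_mem[t st]]|/hasPn h] := boolP (has (fun s => s \in matched M) e); last first.
  by congr (free_red (map _ _)); apply/esym/all_filterP/allP.
have [f1 [x [y [f2 [eE xy]]]]] : exists f1 x y f2, e = f1 ++ x :: y :: f2 /\ M (x, y).
  have te := cl _ _ st se.
  have nts : t <> s by move=> e'; rewrite e' in st; exact: matching_neq st.
  case/splitPr: se srt cl te => e1 e2 srt cl.
  rewrite mem_cat inE => /or3P[te|/eqP//|te].
    case/splitPr: te srt cl => e3 e4; rewrite -catA /= => srt cl.
    by apply: adjacent_pair => //; exact: matching_sym st.
  by case/splitPr: te srt cl => e3 e4 srt cl; exact: adjacent_pair.
subst e; have srt' : wsorted (f1 ++ f2) by exact: (@wsorted_cat2 f1 [:: x; y]).
have xs : x \in matched M by apply/mem_set; exists y.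
have ys : y \in matched M by apply/mem_set; exists x; exact: matching_sym xy.
rewrite filter_cat /= xs ys /= -filter_cat map_cat /= (matching_letter mM xy).
rewrite free_red_cancel -map_cat; apply: IH => //.
  by apply: leq_trans sz; rewrite !size_cat /= !addnS ltnS leqnSn.
move=> p q pq pe; have [px py _] := wsorted_adjacent srt pe.
have : q \in f1 ++ x :: y :: f2.
  by apply: cl pq _; move: pe; rewrite !mem_cat !inE => /orP[->//|->]; rewrite !orbT.
rewrite !mem_cat !inE => /or4P[->//|/eqP e|/eqP e|->]; rewrite ?orbT //; exfalso; subst q.
  by have := matching_fun mM (matching_sym mM pq) xy.
by have := matching_fun mM (matching_sym mM pq) (matching_sym mM xy).
Qed.

End SortedSequences.

(** * Compactness *)

Section Projection.
Variable A : eqType.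
Implicit Types (w v : word A) (F : seq A).

Lemma proj_exists w F : exists2 e : seq (dom w), wsorted e &
  forall s, (s \in e) = ((letter s).1 \in F).
Proof.
have [e He] : exists e : seq (dom w), forall s, (letter s).1 \in F -> s \in e.
  elim: F => [|a F [e He]]; first by exists [::].
  have fib b : exists e' : seq (dom w), letter (w := w) @^-1` [set (a, b)] = [set` e'].
    by apply/finite_seqP; exact: letter_fin.
  have [[e1 E1] [e2 E2]] := (fib true, fib false).
  exists (e1 ++ e2 ++ e) => s.
  rewrite inE !mem_cat => /orP[/eqP sa|/He->]; last by rewrite !orbT.
  case E : (letter s) sa => [b []] /= sa; subst b.
    have : [set` e1] s by rewrite -E1.
    by move=> /= ->.
  have : [set` e2] s by rewrite -E2.
  by move=> /= ->; rewrite orbT.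
exists (sort (@wle _ w) (undup [seq s <- e | (letter s).1 \in F])).
  by rewrite /wsorted sort_uniq undup_uniq sort_sorted //; exact: wle_total.
by move=> s; rewrite mem_sort mem_undup mem_filter; case: (boolP (_ \in F)) => //= /He.
Qed.

Definition wproj w F : seq (dom w) := sval (cid2 (proj_exists w F)).

Lemma proj_sorted w F : wsorted (wproj w F).
Proof. by rewrite /wproj; case: cid2. Qed.

Lemma mem_proj w F s : (s \in wproj w F) = ((letter s).1 \in F).
Proof. by rewrite /wproj; case: cid2. Qed.

(* The image of [w] in the free group on [F]. *)
Definition proj_red w F : seq (sletter A) := free_red (map (@letter _ w) (wproj w F)).

(** Paired positions carry the same letter up to inversion, so a projection keeps both or neither,
    and what remains of the projection of [w] is the projection of [v]. *)
Lemma cancels_to_proj_red w v F : cancels_to w v -> proj_red w F = proj_red v F.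
Proof.
move=> /cancels_toE[T [phi [/cancellation_matching[M mM <-] inj mono let_ rg]]].
rewrite /proj_red (free_red_matching mM (proj_sorted w F)); last first.
  by move=> p q /(matching_letter mM); rewrite !mem_proj => ->.
suff -> : [seq s <- wproj w F | s \notin matched M] = map phi (wproj v F).
  by rewrite -map_comp; congr free_red; apply: eq_map => s /=; rewrite let_.
have /andP[uw sw] := proj_sorted w F; have /andP[uv sv] := proj_sorted v F.
apply: (@sorted_eq _ (@wle _ w)).
- exact: wle_trans.
- exact: wle_anti.
- by apply: sorted_filter => //; exact: wle_trans.
- by rewrite sorted_map (eq_sorted (e' := @wle _ v)).
apply: uniq_perm; rewrite ?filter_uniq ?map_inj_uniq // => s.
rewrite mem_filter mem_proj; apply/andP/mapP.
  move=> [/negP ns sF]; have : (~` matched M) s by move=> h; apply: ns; exact/mem_set.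
  by rewrite -rg => -[t _ tE]; exists t; rewrite // mem_proj -let_ tE.
move=> [t tF ->]; split; last by rewrite let_ -mem_proj.
apply/negP => /set_mem h; have : (~` matched M) (phi t) by rewrite -rg; exists t.
exact.
Qed.

Lemma word_equiv_proj_red w v F : word_equiv w v -> proj_red w F = proj_red v F.
Proof.
by elim=> [x y /cancels_to_proj_red|//|x y _ ->|x y z _ -> _ ->].
Qed.

Lemma proj_red_wempty F : proj_red (wempty A) F = [::].
Proof. by rewrite /proj_red; case: (wproj _ F) => // -[]. Qed.

Lemma ultra_finite (I : Type) (U : set_system I) (T : eqType) (l : seq T) (f : I -> T) :
  UltraFilter U -> U [set i | f i \in l] -> exists s, U [set i | f i = s].
Proof.
move=> UU; elim: l => [h|x l IH h]; first by have [i /=] := filter_ex h.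
have [fx|nfx] := in_ultra_setVsetC [set i | f i = x] UU; first by exists x.
apply: IH; apply: filterS2 h nfx => i /=; rewrite inE => /orP[/eqP//|//].
Qed.

Lemma full_matching_exists w : (forall F, proj_red w F = [::]) ->
  exists2 M : set (dom w * dom w), matching M & matched M = setT.
Proof.
move=> null; have /choice[star Hstar] := fun F => finite_matching_exists (proj_sorted w F) (null F).
(* The finite alphabets are directed by inclusion; an ultrafilter containing all these cones sees
   every given position eventually. *)
pose large (F0 : seq A) : set (seq A) := [set F | {subset F0 <= F}].
have FF : ProperFilter (filter_from setT large).
  apply: filter_from_proper => [|F0 _]; last by exists F0.
  apply: filter_fromT_filter; first by exists [::].
  by move=> F1 F2; exists (F1 ++ F2) => F h; split=> a aF; apply: h; rewrite mem_cat aF ?orbT.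
have [U [UU sU]] := ultraFilterLemma FF.
have Ularge (s : dom w) : U [set F | (letter s).1 \in F].
  by apply: sU; exists [:: (letter s).1] => // F; apply; rewrite mem_head.
have inproj F (s : dom w) : (letter s).1 \in F -> s \in wproj w F by rewrite mem_proj.
pose M : set (dom w * dom w) := [set p | U [set F | star F p.1 = p.2]].
exists M.
  split; rewrite /M /=.
  - move=> s t st; apply: (filterS2 _ _ st (Ularge s)) => F /= <- sF.
    by have [] := Hstar F s (inproj _ _ sF).
  - move=> s t t' st st'; have [F []] := filter_ex (filterI st st').
    by move=> /= -> .
  - move=> s t st; have [F [/= <-]] := filter_ex (filterI st (Ularge s)).
    by move=> sF; have [] := Hstar F s (inproj _ _ sF).
  - move=> s t r st b.
    (* The partner of [r] ranges over a finite fibre as [F] varies, hence is constant on a set of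
       the ultrafilter. *)
    have [l lE] : exists l : seq (dom w), letter (w := w) @^-1` [set sinv (letter r)] = [set` l].
      by apply/finite_seqP; exact: letter_fin.
    have [|r' rr'] := @ultra_finite _ U _ l (star ^~ r) UU.
      apply: filterS (Ularge r) => F /= sF; have [_ _ h _] := Hstar F _ (inproj _ _ sF).
      by have : [set` l] (star F r) by rewrite -lE.
    exists r' => //.
    have [F [[/= stF rF] [sF rr'F]]] :=
      filter_ex (filterI (filterI st (Ularge r)) (filterI (Ularge s) rr')).
    have [_ _ _ h] := Hstar F s (inproj _ _ sF).
    by rewrite -stF -rr'F; apply: h; [exact: inproj|rewrite stF].
apply/seteqP; split=> // s _.
have [l lE] : exists l : seq (dom w), letter (w := w) @^-1` [set sinv (letter s)] = [set` l].
  by apply/finite_seqP; exact: letter_fin.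
have [|t st] := @ultra_finite _ U _ l (star ^~ s) UU; last by exists t.
apply: filterS (Ularge s) => F /= sF; have [_ _ h _] := Hstar F _ (inproj _ _ sF).
by have : [set` l] (star F s) by rewrite -lE.
Qed.

Theorem trivial_full_matching w : bf w = 1%g ->
  exists2 M : set (dom w * dom w), matching M & matched M = setT.
Proof.
move=> /bfP w1; apply: full_matching_exists => F.
by rewrite (word_equiv_proj_red F w1) proj_red_wempty.
Qed.

End Projection.

(** * Occurrences of letters *)

Section Occurrences.
Variable A : eqType.
Implicit Types (w v u : word A) (a : A).

Lemma ncard_seq (T : eqType) (l : seq T) : uniq l -> ncard [set` l] = size l.
Proof.
move=> ul; suff ln : ([set` l] #= `I_(size l))%card.
  rewrite /ncard; case: xgetP => [n _ /= h|/(_ (size l))//].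
  by apply/card_eq_II; apply: card_eq_trans ln; rewrite card_eq_sym.
case: l ul => [|x l] ul; first by rewrite set_nil II0 card_eq0.
have -> : [set` x :: l] = nth x (x :: l) @` `I_(size (x :: l)).
  apply/seteqP; split=> [y /= yl|_ [i /= il <-]]; last exact: mem_nth.
  by exists (index y (x :: l)); [rewrite -index_mem in yl|exact: nth_index].
apply: inj_card_eq => i j /set_mem /= il /set_mem /= jl /eqP.
by rewrite nth_uniq // => /eqP.
Qed.

Lemma occurrencesE w a : occurrences w a = size (wproj w [:: a]).
Proof.
have /andP[u _] := proj_sorted w [:: a].
rewrite -ncard_seq //; congr ncard; apply/seteqP; split=> s /=;
  by rewrite mem_proj inE => /eqP.
Qed.

(** Letters are compared only up to inversion, so that the count also applies to [winv]. *)
Lemma occurrences_sum w v u (f : dom v -> dom w) (g : dom u -> dom w) a :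
  injective f -> injective g -> (forall s t, f s <> g t) ->
  (forall r, (exists s, f s = r) \/ (exists t, g t = r)) ->
  (forall s, (letter (f s)).1 = (letter s).1) ->
  (forall t, (letter (g t)).1 = (letter t).1) ->
  occurrences w a = (occurrences v a + occurrences u a)%N.
Proof.
move=> fi gi fg cover lf lg; rewrite !occurrencesE.
rewrite -(size_map f) -(size_map g (wproj u _)) -size_cat.
have /andP[uw _] := proj_sorted w [:: a]; have /andP[uv _] := proj_sorted v [:: a].
have /andP[uu _] := proj_sorted u [:: a].
apply: perm_size; apply: uniq_perm => // [|r].
  rewrite cat_uniq !map_inj_uniq // uv uu /= andbT.
  by apply/hasPn => _ /mapP[t _ ->]; apply/mapP => -[s _ /esym/fg].
rewrite mem_cat mem_proj; have [[s <-]|[t <-]] := cover r.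
  rewrite lf mem_map // mem_proj; case: (_ \in _) => //=.
  by apply/esym/mapP => -[t _ /fg].
rewrite lg (mem_map gi) mem_proj orbC; case: (_ \in _) => //=.
by apply/esym/mapP => -[s _ /esym/fg].
Qed.

Lemma occurrences_wempty a : occurrences (wempty A) a = 0%N.
Proof. by rewrite occurrencesE; case: (wproj _ _) => // -[]. Qed.

Lemma occurrences_bij w v (f : dom v -> dom w) a : injective f ->
  (forall r, exists s, f s = r) -> (forall s, (letter (f s)).1 = (letter s).1) ->
  occurrences w a = occurrences v a.
Proof.
move=> fi fs lf.
rewrite (@occurrences_sum w v (wempty A) f (fun t => match t with end)) //.
- by rewrite occurrences_wempty addn0.
- by move=> r; left.
Qed.

Lemma occurrences_cat w v a :
  occurrences (wcat w v) a = (occurrences w a + occurrences v a)%N.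
Proof.
apply: (@occurrences_sum (wcat w v) w v inl inr) => //.
- by move=> s t [].
- by move=> s t [].
- by move=> [s|s]; [left|right]; exists s.
Qed.

Lemma sval_injective w (P : set (dom w)) :
  injective (fun s : dom (wrestrict P) => sval s : dom w).
Proof. exact: mono_injective (@sval_mono A w P). Qed.

Lemma occurrences_winv w a : occurrences (winv w) a = occurrences w a.
Proof. by apply: (@occurrences_bij (winv w) w id) => // r; exists r. Qed.

Lemma occurrences_restrictD w (P Q U : set (dom w)) a :
  P `&` Q = set0 -> P `|` Q = U ->
  occurrences (wrestrict U) a =
  (occurrences (wrestrict P) a + occurrences (wrestrict Q) a)%N.
Proof.
move=> PQ0 PQU.
have PU (s : dom w) : P s -> U s by rewrite -PQU; left.
have QU (s : dom w) : Q s -> U s by rewrite -PQU; right.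
pose f (s : dom (wrestrict P)) : dom (wrestrict U) := exist _ (sval s) (PU _ (svalP s)).
pose g (s : dom (wrestrict Q)) : dom (wrestrict U) := exist _ (sval s) (QU _ (svalP s)).
apply: (@occurrences_sum (wrestrict U) (wrestrict P) (wrestrict Q) f g) => //.
- by move=> s t /(congr1 (fun x : dom (wrestrict U) => sval x)) /= /sval_injective.
- by move=> s t /(congr1 (fun x : dom (wrestrict U) => sval x)) /= /sval_injective.
- move=> [s Ps] [t Qt] /(congr1 (fun x : dom (wrestrict U) => sval x)) /= e.
  have : (P `&` Q) s by split=> //; rewrite e.
  by rewrite PQ0.
move=> [r Ur]; have : (P `|` Q) r by rewrite PQU.
by move=> [Pr|Qr]; [left; exists (exist _ r Pr)|right; exists (exist _ r Qr)];
  apply: sval_injective.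
Qed.

Lemma occurrences_restrictT w a : occurrences (wrestrict (setT : set (dom w))) a = occurrences w a.
Proof.
apply/esym; apply: (@occurrences_bij w (wrestrict setT) sval) => //.
- exact: sval_injective.
- by move=> r; exists (exist _ r I).
Qed.

Lemma occurrences_restrictC w (P : set (dom w)) a :
  occurrences w a = (occurrences (wrestrict P) a + occurrences (wrestrict (~` P)) a)%N.
Proof.
rewrite -occurrences_restrictT; apply: occurrences_restrictD; first exact: setICr.
exact: setUv.
Qed.

Lemma occurrences_wletter (x : sletter A) a : occurrences (wletter x) a = (x.1 == a).
Proof.
rewrite occurrencesE; have /andP[u _] := proj_sorted (wletter x) [:: a].
have mem := mem_proj (w := wletter x) [:: a] tt; rewrite inE /= in mem.
case: (wproj _ _) u mem => [|[] [|[] l]] //=.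
  by rewrite in_nil => _ <-.
  by rewrite (@mem_head (dom (wletter x))) => _ <-.
by rewrite (@mem_head (dom (wletter x))).
Qed.

Lemma wordP w : (forall a, occurrences w a = 0%N) -> forall s : dom w, False.
Proof.
move=> w0 s; have := mem_proj [:: (letter s).1] s.
by move: (w0 (letter s).1); rewrite occurrencesE inE eqxx => /size0nil ->.
Qed.

Lemma bf_iso w v : word_iso w v -> bf w = bf v.
Proof. by move=> /iso_equiv/bfP. Qed.

Lemma bf_cat w v : bf (wcat w v) = (bf w * bf v)%g.
Proof. by rewrite -[RHS]/(bf_mul (bf w) (bf v)) bf_mulE. Qed.

Lemma bf_winv w : bf (winv w) = (bf w)^-1%g.
Proof. by rewrite -[RHS]/(bf_inv (bf w)) bf_invE. Qed.

Lemma bf_cancel w (T : set (dom w)) : cancellation T -> bf (wrestrict (~` T)) = bf w.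
Proof.
move=> cT; apply/bfP; apply: rst_sym; apply: rst_step; exists T; split=> //.
by exists id; split=> //; exists id.
Qed.

Lemma bf_restrictD w (P Q U : set (dom w)) : (forall s t, P s -> Q t -> ~~ wle t s) ->
  P `|` Q = U -> bf (wrestrict U) = (bf (wrestrict P) * bf (wrestrict Q))%g.
Proof.
move=> PQ PQU.
have PU (s : dom w) : P s -> U s by rewrite -PQU; left.
have QU (s : dom w) : Q s -> U s by rewrite -PQU; right.
rewrite -bf_cat; apply/esym/bf_iso.
pose phi (x : dom (wcat (wrestrict P) (wrestrict Q))) : dom (wrestrict U) :=
  match x with
  | inl s => exist _ (sval s) (PU _ (svalP s))
  | inr s => exist _ (sval s) (QU _ (svalP s))
  end.
have phi_mono : {mono phi : s t / wle s t}.
  move=> [[s Ps]|[s Qs]] [[t Pt]|[t Qt]] //.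
    have h : wle s t by have := PQ _ _ Ps Qt; have /orP[//|->] := wle_total s t.
    exact: h.
  have /negbTE h := PQ _ _ Pt Qs; exact: h.
exists phi; split=> //; last by case.
have inj := mono_injective phi_mono.
have surj r : exists s, phi s = r.
  case: r => r Ur; have : (P `|` Q) r by rewrite PQU.
  by move=> [Pr|Qr]; [exists (inl (exist _ r Pr))|exists (inr (exist _ r Qr))];
    apply: sval_injective.
have [psi psiK] := choice surj.
by exists psi => // s; apply: inj; rewrite psiK.
Qed.

Lemma bf_restrictT w : bf (wrestrict (setT : set (dom w))) = bf w.
Proof.
apply: bf_iso; exists sval; split=> //.
by exists (fun s => exist _ s I) => // -[s []].
Qed.

End Occurrences.

(** * Lengths and initial segments *)

Section Length.
Variable A : eqType.
Implicit Types (w v u : word A) (g h k p q : bigfree A) (a : A) (x : sletter A).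

Lemma reduced_formP g : reduced (reduced_form g) /\ bf (reduced_form g) = g.
Proof.
rewrite /reduced_form; case: xgetP => [w _ //|no]; exfalso.
have [T cT red] := reduced_exists (repr g).
by apply: (no (wrestrict (~` T))); split=> //; rewrite bf_cancel // bf_repr.
Qed.

(** Such a pair would restrict to a nonempty matching of the reduced word [v]. For a concatenation
    of two reduced words it follows that every pair crosses the join. *)
Lemma unmatched_embedding u v (phi : dom v -> dom u) (M : set (dom u * dom u)) s t :
  {mono phi : s t / wle s t} -> (forall s, letter (phi s) = letter s) ->
  convex (range phi) -> reduced v -> matching M -> ~ M (phi s, phi t).
Proof.
move=> mono let_ cv /reducedP red mM st.
have mN := matching_sub mM cv.
have /red h : matching [set p : dom v * dom v |
    [set p | [/\ M p, range phi p.1 & range phi p.2]] (phi p.1, phi p.2)].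
  by apply: (matching_preimage mono let_ mN) => s' t' [_ _ /= [t'' _ e]]; exists t''.
suff : (set0 : set (dom v * dom v)) (s, t) by [].
by rewrite -h; split=> //=; [exists s|exists t].
Qed.

Lemma range_inl_convex w v : @convex _ (wcat w v) (range inl).
Proof.
apply: convexP => _ _ r [s _ <-] [t _ <-]; case: r => r //= _ _.
by exists r.
Qed.

Lemma range_inr_convex w v : @convex _ (wcat w v) (range inr).
Proof.
apply: convexP => _ _ r [s _ <-] [t _ <-]; case: r => r //= _ _.
by exists r.
Qed.

Lemma matching_inl w v (M : set (dom (wcat w v) * dom (wcat w v))) s y :
  reduced w -> matching M -> M (inl s, y) -> exists t, y = inr t.
Proof.
move=> red mM; case: y => y sy; last by exists y.
exfalso; apply: (@unmatched_embedding (wcat w v) w inl M s y) => //.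
exact: range_inl_convex.
Qed.

Lemma matching_inr w v (M : set (dom (wcat w v) * dom (wcat w v))) t y :
  reduced v -> matching M -> M (inr t, y) -> exists s, y = inl s.
Proof.
move=> red mM; case: y => y sy; first by exists y.
exfalso; apply: (@unmatched_embedding (wcat w v) v inr M t y) => //.
exact: range_inr_convex.
Qed.

(** The word [wcat (winv w) v] is trivial, so all its positions can be matched; every pair crosses
    the join, which makes the matching a bijection from [dom w] to [dom v]. *)
Lemma reduced_occurrences w v a : reduced w -> reduced v -> bf w = bf v ->
  occurrences w a = occurrences v a.
Proof.
move=> rw rv wv; have rw' := reduced_winv rw.
have [|M mM full] := @trivial_full_matching A (wcat (winv w) v).
  by rewrite bf_cat bf_winv wv mulVg.
have /choice[f Hf] : forall s : dom w, exists t : dom v, M (inl s, inr t).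
  move=> s; have [y sy] : matched M (inl s) by rewrite full.
  by have [t yt] := matching_inl rw' mM sy; exists t; rewrite -yt.
apply/esym/(@occurrences_bij _ v w f) => [s t e|t|s].
- have := matching_fun mM (matching_sym mM (Hf s)); rewrite e.
  by move=> /(_ _ (matching_sym mM (Hf t))) [].
- have [y ty] : matched M (inr t) by rewrite full.
  have [s ys] := matching_inr rv mM ty; exists s; rewrite ys in ty.
  by have [] := matching_fun mM (Hf s) (matching_sym mM ty).
- by have /= -> := matching_letter mM (Hf s); rewrite sinvK.
Qed.

Definition len g a : nat := occurrences (reduced_form g) a.

Lemma lenE w g a : reduced w -> bf w = g -> len g a = occurrences w a.
Proof.
by move=> rw wg; have [rg gE] := reduced_formP g; apply: reduced_occurrences; rewrite // gE.
Qed.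

Lemma occurrences_restrict_le w (P : set (dom w)) a :
  (occurrences (wrestrict P) a <= occurrences w a)%N.
Proof. by rewrite (occurrences_restrictC P) leq_addr. Qed.

Lemma len_mul g h a : (len (g * h)%g a <= len g a + len h a)%N.
Proof.
have [_ gE] := reduced_formP g; have [_ hE] := reduced_formP h.
have [T cT red] := reduced_exists (wcat (reduced_form g) (reduced_form h)).
rewrite (lenE _ red); last by rewrite bf_cancel // bf_cat gE hE.
by rewrite /len -occurrences_cat occurrences_restrict_le.
Qed.

Lemma len_inv g a : len (g^-1)%g a = len g a.
Proof.
have [rg gE] := reduced_formP g.
by rewrite (lenE _ (reduced_winv rg)) ?bf_winv ?gE // occurrences_winv.
Qed.

Lemma reduced_wempty : reduced (wempty A).
Proof. by move=> T _; apply/seteqP; split=> // -[]. Qed.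

Lemma len1 a : len 1%g a = 0%N.
Proof. by rewrite (lenE _ reduced_wempty) // occurrences_wempty. Qed.

Lemma bf_void w : (forall s : dom w, False) -> bf w = 1%g.
Proof.
move=> w0; apply: bf_iso.
exists (fun s => match w0 s with end); split=> [|s|s]; try by case: (w0 s).
exists (fun s : dom (wempty A) => match s : void with end) => [s|[]].
by case: (w0 s).
Qed.

Lemma len_eq0 g : (forall a, len g a = 0%N) -> g = 1%g.
Proof. by move=> g0; have [_ <-] := reduced_formP g; apply/bf_void/wordP. Qed.

Lemma reduced_wletter x : reduced (wletter x).
Proof.
apply/reducedP => M mM; apply/seteqP; split=> // -[[] []] h.
by have := matching_neq mM h.
Qed.

Lemma len_letter x a : len (bf_letter x) a = (x.1 == a).
Proof. by rewrite (lenE _ (@reduced_wletter x)) // occurrences_wletter. Qed.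

Lemma bf_letter_inv x : bf_letter (sinv x) = (bf_letter x)^-1%g.
Proof. by rewrite -bf_winv; apply: bf_iso; exists id; split=> //; exists id. Qed.

Definition initial w (P : set (dom w)) : Prop := forall s r, P s -> wle r s -> P r.

Lemma initial_convex w (P Q : set (dom w)) : initial P -> initial Q -> convex (Q `&` ~` P).
Proof.
move=> iP iQ; apply: convexP => s t r [Qs nPs] [Qt nPt] sr rt; split; first exact: iQ Qt rt.
by move=> Pr; apply: nPs; exact: iP Pr sr.
Qed.

Lemma initial0 w : initial (set0 : set (dom w)).
Proof. by []. Qed.

Lemma initialT w : initial (setT : set (dom w)).
Proof. by []. Qed.

Lemma initial_restrict_reduced w (P : set (dom w)) :
  reduced w -> initial P -> reduced (wrestrict P).
Proof.
move=> rw iP; apply: reduced_restrict rw _.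
by have := initial_convex (@initial0 w) iP; rewrite setC0 setIT.
Qed.

Lemma initial_total w (P Q : set (dom w)) : initial P -> initial Q -> P `<=` Q \/ Q `<=` P.
Proof.
move=> iP iQ; have [|/existsNP[s /not_implyP[Ps nQs]]] := pselect (P `<=` Q); first by left.
right=> t Qt; have /orP[st|ts] := wle_total s t; last exact: iP Ps ts.
by exfalso; apply: nQs; exact: iQ Qt st.
Qed.

(* [p] is an initial segment of [g]: the product [p * (p^-1 * g)] is reduced. *)
Definition bf_prefix p g : Prop := forall a, len g a = (len p a + len (p^-1 * g)%g a)%N.

Lemma initial_bf w (P Q : set (dom w)) : initial P -> initial Q -> P `<=` Q ->
  bf (wrestrict Q) = (bf (wrestrict P) * bf (wrestrict (Q `&` ~` P)))%g.
Proof.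
move=> iP iQ PQ; apply: bf_restrictD.
  by move=> s t Ps [_ nPt]; apply/negP => ts; apply: nPt; exact: iP Ps ts.
apply/seteqP; split=> s; first by move=> [/PQ|[]].
by move=> Qs; have [Ps|nPs] := pselect (P s); [left|right].
Qed.

Lemma initial_prefix w (P Q : set (dom w)) : reduced w -> initial P -> initial Q ->
  P `<=` Q -> bf_prefix (bf (wrestrict P)) (bf (wrestrict Q)).
Proof.
move=> rw iP iQ PQ a; rewrite (initial_bf iP iQ PQ) mulKg -(initial_bf iP iQ PQ).
rewrite !(lenE _ _ (erefl _)); try exact: initial_restrict_reduced.
  apply: occurrences_restrictD.
    by apply/seteqP; split=> // s [Ps [_ nPs]].
  apply/seteqP; split=> s; first by move=> [/PQ|[]].
  by move=> Qs; have [Ps|nPs] := pselect (P s); [left|right].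
exact/(reduced_restrict rw)/initial_convex.
Qed.

(** The triangle inequalities for [p^-1 * k] and for [k] bound the lengths from both sides. *)
Lemma bf_prefix_trans p q k : bf_prefix p q -> bf_prefix q k -> bf_prefix p k.
Proof.
move=> pq qk a; have := pq a; have := qk a.
have e1 : (p^-1 * k = (p^-1 * q) * (q^-1 * k))%g by rewrite -mulgA mulVKg.
have e2 : (k = p * (p^-1 * k))%g by rewrite mulVKg.
have := len_mul (p^-1 * q)%g (q^-1 * k)%g a; rewrite -e1.
by have := len_mul p (p^-1 * k)%g a; rewrite -e2; lia.
Qed.

Lemma full_matching_trivial w (M : set (dom w * dom w)) :
  matching M -> matched M = setT -> bf w = 1%g.
Proof.
move=> /matching_cancellation cM full; rewrite -(bf_cancel cM) full.
by apply: bf_void => -[s []].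
Qed.

Lemma common_initial g h : exists (P : set (dom (reduced_form g)))
    (Q : set (dom (reduced_form h))),
  [/\ initial P, initial Q, bf (wrestrict P) = bf (wrestrict Q) &
    forall a, len (g^-1 * h)%g a =
      (len ((bf (wrestrict P))^-1 * g)%g a + len ((bf (wrestrict Q))^-1 * h)%g a)%N].
Proof.
have [rg gE] := reduced_formP g; have [rh hE] := reduced_formP h.
set G := reduced_form g in rg gE *; set H := reduced_form h in rh hE *.
have rg' := reduced_winv rg.
have [M mM red] := maximal_matching (wcat (winv G) H).
pose P : set (dom G) := [set s | matched M (inl s)].
pose Q : set (dom H) := [set t | matched M (inr t)].
(* A pair crosses the join, so its interval contains all positions between either member and the
   join; in [G], which is read backwards, these are the earlier ones. *)
have iP : initial P.
  move=> s r [y sy] rs; have [t yt] := matching_inl rg' mM sy; rewrite yt in sy.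
  have [|r' rr' _] := matching_between mM (r := inl r) sy; last by exists r'.
  by apply/betweenP; left.
have iQ : initial Q.
  move=> t r [y ty] rt; have [s ys] := matching_inr rh mM ty; rewrite ys in ty.
  have [|r' rr' _] := matching_between mM (r := inr r) ty; last by exists r'.
  by apply/betweenP; right.
exists P, Q; split=> //.
  (* Restricted to [P] and [Q], [M] matches every position, so the quotient of the two initial
     segments is trivial. *)
  pose phi (x : dom (wcat (winv (wrestrict P)) (wrestrict Q))) : dom (wcat (winv G) H) :=
    match x with inl s => inl (sval s) | inr t => inr (sval t) end.
  have mono : {mono phi : s t / wle s t} by move=> [s|s] [t|t].
  have let_ s : letter (phi s) = letter s by case: s.
  have cover (x y : dom (wcat (winv G) H)) : M (x, y) -> exists y', phi y' = y.
    case: y => y xy.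
      have Py : P y by exists x; exact: matching_sym xy.
      by exists (inl (exist _ y Py)).
    have Qy : Q y by exists x; exact: matching_sym xy.
    by exists (inr (exist _ y Qy)).
  have mN := matching_preimage mono let_ mM (fun s t => @cover (phi s) t).
  have : bf (wcat (winv (wrestrict P)) (wrestrict Q)) = 1%g.
    apply: full_matching_trivial mN _; apply/seteqP; split=> // x _.
    have [y xy] : matched M (phi x).
      by case: x => -[x hx]; exact: hx.
    by have [y' y'E] := cover _ _ xy; exists y'; rewrite /= y'E.
  rewrite bf_cat bf_winv => e.
  by rewrite -[RHS](mulVKg (bf (wrestrict P))) e mulg1.
move=> a; have cM := matching_cancellation mM.
rewrite (lenE _ red); last by rewrite (bf_cancel cM) bf_cat bf_winv gE hE.
have gP : ((bf (wrestrict P))^-1 * g)%g = bf (wrestrict (~` P)).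
  have := initial_bf iP (@initialT G) (@subsetT _ _).
  by rewrite bf_restrictT gE setTI => ->; rewrite mulKg.
have hQ : ((bf (wrestrict Q))^-1 * h)%g = bf (wrestrict (~` Q)).
  have := initial_bf iQ (@initialT H) (@subsetT _ _).
  by rewrite bf_restrictT hE setTI => ->; rewrite mulKg.
have cP : convex (~` P) by have := initial_convex iP (@initialT G); rewrite setTI.
have cQ : convex (~` Q) by have := initial_convex iQ (@initialT H); rewrite setTI.
rewrite gP hQ (lenE _ (reduced_restrict rg cP)) // (lenE _ (reduced_restrict rh cQ)) //.
pose f (s : dom (wrestrict (~` P))) : dom (wrestrict (~` matched M)) :=
  exist _ (inl (sval s) : dom (wcat (winv G) H)) (svalP s).
pose f' (t : dom (wrestrict (~` Q))) : dom (wrestrict (~` matched M)) :=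
  exist _ (inr (sval t) : dom (wcat (winv G) H)) (svalP t).
pose val_ (x : dom (wrestrict (~` matched M))) : dom (wcat (winv G) H) := sval x.
apply: (@occurrences_sum _ _ (wrestrict (~` P)) (wrestrict (~` Q)) f f') => //.
- by move=> s t /(congr1 val_) [/sval_injective].
- by move=> s t /(congr1 val_) [/sval_injective].
move=> [[r|r] hr]; [left; exists (exist _ r hr)|right; exists (exist _ r hr)];
  exact: sval_injective.
Qed.

Lemma ends_in_len g x a : ends_in g x ->
  len g a = (len (g * bf_letter (sinv x))%g a + (x.1 == a))%N.
Proof.
have [rg gE] := reduced_formP g; set G := reduced_form g in rg gE *.
move=> [m max mx]; pose P : set (dom G) := ~` [set m].
have nm s t : P s -> t = m -> ~~ wle t s.
  by move=> nsm ->; apply/negP => ms; apply: nsm; apply: wle_anti; rewrite ms max.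
have iP : initial P.
  move=> s r Ps rs /= rm; have /negP := nm s r Ps rm; exact.
have iso : word_iso (wletter x) (wrestrict [set m]).
  pose f : dom (wletter x) -> dom (wrestrict [set m]) := fun=> exist [set m] m erefl.
  exists f; split=> //.
    by exists (fun=> tt) => [[]|[s sm]] //; apply: sval_injective.
  by move=> [] []; rewrite /= wle_refl.
have gE2 : g = (bf (wrestrict P) * bf_letter x)%g.
  rewrite /bf_letter (bf_iso iso) -{1}gE -bf_restrictT; apply: bf_restrictD.
    by move=> s t /nm; exact.
  exact: setvU.
have rP := initial_restrict_reduced rg iP.
rewrite bf_letter_inv {2}gE2 mulgK (lenE a rP (erefl _)) (lenE a rg gE).
rewrite (occurrences_restrictC P); congr addn; rewrite setCK.
rewrite -(occurrences_wletter x a); have [f [[f' fK f'K] _ lf]] := iso.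
apply: (@occurrences_bij _ _ (wletter x) f); first exact: can_inj fK.
  by move=> r; exists (f' r).
by move=> s; rewrite lf.
Qed.

Lemma not_ends_in_len g x a : ~ ends_in g (sinv x) ->
  len (g * bf_letter x)%g a = (len g a + (x.1 == a))%N.
Proof.
have [rg gE] := reduced_formP g; rewrite /ends_in; set G := reduced_form g in rg gE *.
move=> nend.
suff red : reduced (wcat G (wletter x)).
  by rewrite (lenE _ red) ?bf_cat ?gE // occurrences_cat occurrences_wletter (lenE _ rg).
apply/reducedP => M mM.
(* If the new letter were paired with [s], then [s] would not be the last position of [G]; a later
   [r] would need a partner across the join, where the only position is already taken. *)
have nlast t y : ~ M (inr t, y).
  case: t => ty; have [s sy] := matching_inr (@reduced_wletter x) mM ty; rewrite sy in ty.
  have ls : letter s = sinv x := matching_letter mM ty.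
  have [r nr] : exists r : dom G, ~ wle r s.
    by apply: contrapT => /forallNP h; apply: nend; exists s => // t; apply: contrapT; exact: h.
  have sr : wle s r by have /orP[//|/nr] := wle_total s r.
  have b : between (inr tt : dom (wcat G (wletter x))) (inl s) (inl r).
    by apply/betweenP; right.
  have [r' rr' b'] := matching_between mM ty b.
  case: r' rr' b' => [r'|[]] rr' _.
    by have [t] := matching_inl rg mM rr'.
  have [e] := matching_fun mM ty (matching_sym mM rr').
  by apply: nr; rewrite e wle_refl.
apply/seteqP; split=> // -[[s|s] y] sy; last exact: nlast sy.
have [t yt] := matching_inl rg mM sy; rewrite yt in sy.
exact: nlast (matching_sym mM sy).
Qed.

Lemma ends_in_unique g x y : ends_in g x -> ends_in g y -> x = y.
Proof.
by move=> [s hs <-] [t ht <-]; congr letter; apply: wle_anti; rewrite hs ht.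
Qed.

End Length.

(** * The Gromov product of the big free group *)

Section BfLength.
Context (d : Order.disp_t) (A : wellOrderType d) (R : realType).
Local Notation Lam := (lexpow A R).
Local Notation L := (@bf_length d A R).
Local Notation c := (@overlap d A R).
Implicit Types (g h k u w z : bigfree A) (a : A) (x : sletter A).

Lemma lex_le_pointwise (u v : Lam) : (forall a, u a <= v a) -> u <= v.
Proof. by move=> uv; rewrite leNgt; apply/negP => /lex_ltE[a /lt_geF]; rewrite uv. Qed.

Lemma bf_lengthE g a : L g a = (len g a)%:R.
Proof. by []. Qed.

Lemma bf_length1 : L 1%g = 0.
Proof. by apply/funext => a; rewrite bf_lengthE len1. Qed.

Lemma bf_length_inv g : L g^-1%g = L g.
Proof. by apply/funext => a; rewrite !bf_lengthE len_inv. Qed.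

Lemma bf_length_ge0 g : 0 <= L g.
Proof. by apply: lex_le_pointwise => a; rewrite bf_lengthE ler0n. Qed.

Lemma bf_length_eq0 g : L g = 0 -> g = 1%g.
Proof.
move=> g0; apply: len_eq0 => a; apply/eqP; rewrite -(@pnatr_eq0 R).
by rewrite -bf_lengthE g0.
Qed.

Lemma bf_length_mul g h : L (g * h)%g <= L g + L h.
Proof. by apply: lex_le_pointwise => a; rewrite lexpowD !bf_lengthE -natrD ler_nat len_mul. Qed.

Lemma bf_length_prefix p g : bf_prefix p g -> L g = L p + L (p^-1 * g)%g.
Proof. by move=> pg; apply/funext => a; rewrite lexpowD !bf_lengthE -natrD pg. Qed.

Lemma lex_half (u : Lam) : 2^-1 *: u + 2^-1 *: u = u.
Proof. by apply/funext => a; rewrite lexpowD lexpowZ; lra. Qed.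

Lemma overlapD g h : c g h + c g h = L g + L h - L (g^-1 * h)%g.
Proof. exact: lex_half. Qed.

Lemma overlap_bf_length g h :
  L (g^-1 * h)%g = L g + L h - (c g h + c g h).
Proof. rewrite overlapD; lexlra. Qed.

Lemma overlapC g h : c g h = c h g.
Proof.
have := overlapD g h; have := overlapD h g.
rewrite -(bf_length_inv (h^-1 * g)%g) invgM invgK; lexlra.
Qed.

Lemma overlapxx g : c g g = L g.
Proof. have := overlapD g g; rewrite mulVg bf_length1; lexlra. Qed.

Lemma overlap_le g h : c g h <= L g.
Proof.
have := overlapD g h; have := bf_length_mul g (g^-1 * h)%g.
by rewrite mulVKg; lexlra.
Qed.

(** Apply the triangle inequality to [g^-1 * h], the product of the inverse of [p^-1 * g] with
    [p^-1 * h]. *)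
Lemma prefix_overlap p g h : bf_prefix p g -> bf_prefix p h -> L p <= c g h.
Proof.
move=> /bf_length_prefix pg /bf_length_prefix ph.
have := bf_length_mul (p^-1 * g)^-1%g (p^-1 * h)%g.
rewrite bf_length_inv invgM invgK.
have -> : (g^-1 * p * (p^-1 * h) = g^-1 * h)%g by rewrite -mulgA mulVKg.
by move: (overlapD g h) pg ph; lexlra.
Qed.

Lemma initial_reduced_form_prefix g (P : set (dom (reduced_form g))) :
  initial P -> bf_prefix (bf (wrestrict P)) g.
Proof.
move=> iP; have [rg gE] := reduced_formP g.
have := initial_prefix rg iP (@initialT _ _) (@subsetT _ _).
by rewrite bf_restrictT gE.
Qed.

Lemma overlap_common g h : exists (P : set (dom (reduced_form g)))
    (Q : set (dom (reduced_form h))),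
  [/\ initial P, initial Q, bf (wrestrict P) = bf (wrestrict Q)
    & c g h = L (bf (wrestrict P))].
Proof.
have [P [Q [iP iQ PQ len_gh]]] := common_initial g h; exists P, Q; split=> //.
have /bf_length_prefix pg := initial_reduced_form_prefix iP.
have /bf_length_prefix ph := initial_reduced_form_prefix iQ.
have : L (g^-1 * h)%g = L ((bf (wrestrict P))^-1 * g)%g + L ((bf (wrestrict Q))^-1 * h)%g.
  by apply/funext => a; rewrite lexpowD !bf_lengthE -natrD len_gh.
by move: (overlapD g h) pg ph; rewrite -PQ; lexlra.
Qed.

Lemma overlap_ge0 g h : 0 <= c g h.
Proof. by have [P [Q [_ _ _ ->]]] := overlap_common g h; exact: bf_length_ge0. Qed.

(* Both common prefixes are initial segments of the reduced form of [h], hence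
   comparable. *)
Lemma overlap_ultra g h k : Order.min (c g h) (c h k) <= c g k.
Proof.
have [P [Q [iP iQ PQ ->]]] := overlap_common g h.
have [P' [Q' [iP' iQ' PQ' ->]]] := overlap_common h k.
have [rh hE] := reduced_formP h.
have pg := initial_reduced_form_prefix iP; have qk := initial_reduced_form_prefix iQ'.
rewrite ge_min; apply/orP; rewrite PQ -PQ' in pg qk *.
have [sub|sub] := initial_total iQ iP'; [left|right]; apply: prefix_overlap => //.
  exact: bf_prefix_trans (initial_prefix rh iQ iP' sub) qk.
exact: bf_prefix_trans (initial_prefix rh iP' iQ sub) pg.
Qed.

Lemma bf_length_letter x a : L (bf_letter x) a = (x.1 == a)%:R.
Proof. by rewrite bf_lengthE len_letter. Qed.

Lemma bf_length_sign a (p q : bool) : L (bf_letter (a, p)) = L (bf_letter (a, q)).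
Proof. by apply/funext => b; rewrite !bf_length_letter. Qed.

Lemma bf_length_letter_gt0 x : 0 < L (bf_letter x).
Proof.
rewrite lt_neqAle bf_length_ge0 andbT; apply/eqP => /(congr1 (fun u : Lam => u x.1)).
by rewrite bf_length_letter eqxx lexpow0 => /esym/eqP; rewrite oner_eq0.
Qed.

Lemma bf_length_ends_in g x : ends_in g x ->
  L g = L (g * (bf_letter x)^-1)%g + L (bf_letter x).
Proof.
move=> gx; rewrite -bf_letter_inv; apply/funext => a.
by rewrite lexpowD !bf_lengthE -natrD (ends_in_len a gx) len_letter.
Qed.

Lemma bf_length_not_ends_in g x : ~ ends_in g (sinv x) ->
  L (g * bf_letter x)%g = L g + L (bf_letter x).
Proof.
move=> gx; apply/funext => a.
by rewrite lexpowD !bf_lengthE -natrD (not_ends_in_len a gx) len_letter.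
Qed.

Lemma bf_length_step g x : L (g * bf_letter x)%g = L g + L (bf_letter x) \/
  L g = L (g * bf_letter x)%g + L (bf_letter x).
Proof.
have [gx|gx] := pselect (ends_in g (sinv x)); [right|left; exact: bf_length_not_ends_in].
have := bf_length_ends_in gx; rewrite bf_letter_inv invgK.
by rewrite -bf_letter_inv (bf_length_sign x.1 _ x.2) /=; case: x gx.
Qed.

(** No word branches off inside an edge. If the overlap exceeds [L w], then [c w z = L w]; as the
    lengths of [z^-1 * w] and [z^-1 * w * x] differ by exactly [L x], the overlap is [L w] or
    everything. *)
Lemma overlap_step w x z : L (w * bf_letter x)%g = L w + L (bf_letter x) ->
  c (w * bf_letter x)%g z <= L w \/ c (w * bf_letter x)%g z = L (w * bf_letter x)%g.
Proof.
move=> wx; have [|lt] := leP (c (w * bf_letter x)%g z) (L w); first by left.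
right; have cw : c w (w * bf_letter x)%g = L w.
  by have := overlapD w (w * bf_letter x)%g; rewrite mulKg wx; lexlra.
have := overlap_ultra w (w * bf_letter x)%g z; rewrite cw min_l; last exact: ltW.
have := overlap_le w z; have := overlapD w z; have := overlapD (w * bf_letter x)%g z.
have := bf_length_step (z^-1 * w)%g x.
rewrite -mulgA -(bf_length_inv (z^-1 * w)%g) invgM invgK.
rewrite -(bf_length_inv (z^-1 * (w * bf_letter x))%g) invgM invgK wx.
by move=> [?|?]; lexlra.
Qed.

End BfLength.

(** * The big Cayley graph *)

Section CayleyTree.
Context (d : Order.disp_t) (A : wellOrderType d) (R : realType).
Local Notation Lam := (lexpow A R).
Local Notation L := (@bf_length d A R).
Local Notation c := (@overlap d A R).
Implicit Types (g h k u w z : bigfree A) (a : A) (x y : prepoint A R).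

Local Notation bdist g h := (L g + L h - (c g h + c g h)).

Local Notation pfun := (point_fun L c).
Local Notation tree := (tree_point L c).
Local Notation tdist := (@tree_dist d A R (bigfree A) L c).

Lemma bf_rooted_gromov : rooted_gromov 1%g L c.
Proof.
split.
- exact: overlap_ge0.
- exact: overlapC.
- exact: overlapxx.
- exact: overlap_le.
- exact: overlap_ultra.
- exact: bf_length1.
Qed.

Lemma bf_dist_mull u g h : bdist (u * g)%g (u * h)%g = bdist g h.
Proof. by rewrite -!overlap_bf_length invgM -mulgA mulKg. Qed.

Lemma bf_dist_invl u g h : bdist (u^-1 * g)%g h = bdist g (u * h)%g.
Proof. by rewrite -(bf_dist_mull u) mulVKg. Qed.

(** The translate is the point at distance [m] from [u] on the segment from [u] to [u * x], which
    need not pass through the root; [is_point_between] covers it. *)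
Lemma is_point_act u (p : bigfree A -> Lam) : is_point L c p ->
  is_point L c (fun z => p (u^-1 * z)%g).
Proof.
move=> [x [m [/andP[m0 mx] ->]]].
have uu : bdist u (u * x)%g = L x by rewrite -overlap_bf_length mulKg.
have := is_point_between bf_rooted_gromov (x := u) (y := (u * x)%g) (m := m).
rewrite uu m0 mx => /(_ isT); congr is_point; apply/funext => z.
rewrite point_funE -!bf_dist_invl; congr Order.max.
  congr (_ - m).
  have -> : L (u^-1 * z)%g = bdist (u^-1 * z)%g 1%g; last by rewrite bf_dist_invl mulg1.
  by rewrite -overlap_bf_length mulg1 bf_length_inv.
rewrite (overlapC R x); lexgo.
Qed.

Definition tree_act u (P : tree) : tree := exist _ _ (is_point_act u (svalP P)).

Lemma tree_act_isometric : isometric_action setT tdist tree_act.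
Proof.
split=> [//|P _|g h P _|u P Q _ _].
- by apply: tree_point_eq; apply/funext => z /=; rewrite invg1 mul1g.
- by apply: tree_point_eq; apply/funext => z /=; rewrite invgM mulgA.
apply: sup_distE.
have [bd [z zE]] := tree_dist_attained bf_rooted_gromov P Q.
by split=> [z'|]; [exact: bd|exists (u * z)%g; rewrite /= mulKg].
Qed.

(* Neither endpoint of an edge is distinguished: its points are given by their
   distances to both. *)
Lemma point_fun_edge w (s : sletter A) (v v' : Lam) z : 0 <= v ->
  v + v' = L (bf_letter s) -> L (w * bf_letter s)%g = L w + L (bf_letter s) ->
  pfun (w * bf_letter s)%g (L w + v) z =
  Order.max (bdist z w - v) (bdist z (w * bf_letter s)%g - v').
Proof.
move=> v0 vv ws; rewrite point_funE !(overlapC R z) ws.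
have -> : L z + (L w + L (bf_letter s)) -
    (c (w * bf_letter s)%g z + c (w * bf_letter s)%g z) - v' =
    L z + (L w + v) - (c (w * bf_letter s)%g z + c (w * bf_letter s)%g z).
  by move: vv; lexgo.
have cw : c w (w * bf_letter s)%g = L w.
  by have := overlapD R w (w * bf_letter s)%g; rewrite mulKg ws; lexgo.
have := overlap_le R w z; have := overlap_ultra R w (w * bf_letter s)%g z.
have := overlap_ultra R (w * bf_letter s)%g w z.
rewrite (overlapC R _ w) cw !ge_min => /orP h1 /orP h2 h3.
(* Either [z] follows [w] to its end, or it leaves before the edge and has the same overlap with
   both ends. *)
have [e|e] : c w z = L w \/ (c w z < L w /\ c (w * bf_letter s)%g z = c w z).
  have [e|e] := leP (L w) (c w z); [left|right]; first by apply/le_anti; rewrite h3 e.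
  split=> //; move: e h3; case: h1 => h1; case: h2 => h2; move: h1 h2; lexgo.
- by congr Order.max; move: e; lexgo.
case: e => e1 ->; rewrite max_r; last by move: e1 v0; lexgo.
by rewrite max_r //; move: v0; lexgo.
Qed.

Definition clamp (x : bigfree A) (m : Lam) : Lam := Order.max 0 (Order.min m (L x)).

Lemma clamp_bounds g m : 0 <= clamp g m <= L g.
Proof. by rewrite /clamp le_max lexx ge_max bf_length_ge0 ge_min lexx orbT. Qed.

(* The heights are clamped only to get a total function: [clamp] is the identity
   on the heights of the points of the Cayley graph. *)
Definition embed x : tree := mk_point c (clamp_bounds (tip x) (height x)).

Lemma bf_length_edge w a p t : cayley A R (Edge w a p t) ->
  L (w * bf_letter (a, p))%g = L w + L (bf_letter (a, p)).
Proof. by move=> [_ nend]; apply: bf_length_not_ends_in. Qed.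

Lemma scaled_letter_ge0 a p (t : R) : 0 < t -> 0 <= t *: L (bf_letter (a, p)).
Proof.
move=> t0; apply: lex_le_pointwise => b.
by rewrite lexpowZ lexpow0 bf_lengthE mulr_ge0 ?ler0n // ltW.
Qed.

Lemma scaled_letterD a p (t : R) :
  t *: L (bf_letter (a, p)) + (1 - t) *: L (bf_letter (a, p)) = L (bf_letter (a, p)).
Proof. by rewrite -scalerDl addrC subrK scale1r. Qed.

Lemma height_edge w a p t : height (Edge w a p t : prepoint A R) =
  L w + t *: L (bf_letter (a, p)).
Proof. by rewrite /= (bf_length_sign R a true p). Qed.

Lemma height_bounds x : cayley A R x -> 0 <= height x <= L (tip x).
Proof.
case: x => [w _|w a p t xc]; first by rewrite /= lexx bf_length_ge0.
rewrite height_edge [tip _]/= (bf_length_edge xc).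
case: xc => /andP[t0 t1] _; have := scaled_letterD a p t.
have := scaled_letter_ge0 a p t0; have := bf_length_ge0 R w.
have := @scaled_letter_ge0 a p (1 - t); rewrite subr_gt0 => /(_ t1).
by move=> h1 h2 h3 h4; apply/andP; split; move: h1 h2 h3 h4; lexgo.
Qed.

Lemma embedE x : cayley A R x -> sval (embed x) = pfun (tip x) (height x).
Proof.
move=> /height_bounds/andP[h0 h1]; rewrite /= /clamp min_l // max_r //.
Qed.

Lemma embed_dist x y : cayley A R x -> cayley A R y ->
  tdist (embed x) (embed y) = cayley_dist A R x y.
Proof.
move=> xc yc; rewrite /tree_dist !embedE //.
rewrite (sup_distE (point_dist_common bf_rooted_gromov
  (height_bounds xc) (height_bounds yc))).
by rewrite /cayley_dist /common minA scaler_nat mulr2n.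
Qed.

Lemma nat_add_fraction (m n : nat) (t : R) : 0 < t < 1 -> m%:R + t <> n%:R.
Proof.
move=> /andP[t0 t1] e.
have : (m < n)%N by rewrite -(ltr_nat R) -e ltrDl.
by rewrite -(ler_nat R) -natr1 -e => h; lra.
Qed.

Lemma nat_add_fraction_inj (m n : nat) (t s : R) : 0 < t < 1 -> 0 < s < 1 ->
  m%:R + t = n%:R + s -> m = n /\ t = s.
Proof.
move=> /andP[t0 t1] /andP[s0 s1] e.
have mn : m = n.
  by case: (ltngtP m n) => // lt; exfalso; move: lt; rewrite -(ler_nat R) -natr1 => lt; lra.
by split=> //; rewrite mn in e; exact: addrI e.
Qed.

(** Word lengths have natural coordinates, so a fractional coordinate of the height reveals an edge
    point, its letter and its [t]. The overlap then exceeds [L w], and [overlap_step] makes the tips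
    equal; their last letter gives the exponent. *)
Lemma cayley_separated x y : cayley A R x -> cayley A R y ->
  height x = height y -> height x <= c (tip x) (tip y) -> x = y.
Proof.
have lenZ w a p (t : R) b : (L w + t *: L (bf_letter (a, p))) b = (len w b)%:R + t * (a == b)%:R.
  by rewrite lexpowD lexpowZ bf_length_letter.
have VE w v a p (t : R) : 0 < t < 1 -> L v + t *: L (bf_letter (a, p)) <> L w.
  move=> t01 /(congr1 (fun u : Lam => u a)); rewrite lenZ eqxx mulr1 => e.
  exact: nat_add_fraction t01 e.
case: x => [w|w a p t]; case: y => [v|v b q s] xc yc; rewrite ?height_edge.
- move=> /= wv wc; congr Vertex.
  have : L (w^-1 * v)%g = 0.
    apply/le_anti; rewrite bf_length_ge0 andbT overlap_bf_length.
    by move: wv wc; lexgo.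
  by move=> /bf_length_eq0 e; rewrite -[RHS](mulVKg w) e mulg1.
- by case: yc => s01 _ /= /esym/(VE _ _ _ _ _ s01).
- by case: xc => t01 _ /= /(VE _ _ _ _ _ t01).
have wE := bf_length_edge xc; have vE := bf_length_edge yc.
have [t01 nw] := xc; have [s01 nv] := yc => e wc.
have coord (i : A) : (len w i)%:R + t * (a == i)%:R = (len v i)%:R + s * (b == i)%:R :> R.
  by rewrite -!(lenZ _ _ true) -[LHS]/((L w + t *: L (bf_letter (a, true))) i)
    (bf_length_sign R a true p) e (bf_length_sign R b true q).
have ab : a = b.
  apply/eqP/negPn/negP => /negbTE nab; have := coord a.
  rewrite eqxx eq_sym nab mulr1 mulr0 addr0; exact: nat_add_fraction t01.
subst b; have := coord a; rewrite eqxx !mulr1 => /(nat_add_fraction_inj t01 s01)[_ ts].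
subst s; have wv : L w = L v.
  by apply/(addIr (t *: L (bf_letter (a, p)))); rewrite e (bf_length_sign R a q p).
have tipE : (w * bf_letter (a, p) = v * bf_letter (a, q))%g.
  have t0 : 0 < t *: L (bf_letter (a, p)).
    case/andP: t01 => t0 _; rewrite lt_neqAle scaled_letter_ge0 // andbT.
    apply/eqP => /(congr1 (fun u : Lam => u a)).
    by rewrite lexpowZ bf_length_letter eqxx mulr1 => /esym t00; move: t0; rewrite t00 ltxx.
  have [le|cE] := overlap_step (v * bf_letter (a, q))%g wE.
    by exfalso; move: le wc t0; rewrite /=; lexgo.
  have : L ((w * bf_letter (a, p))^-1 * (v * bf_letter (a, q)))%g = 0.
    rewrite overlap_bf_length cE wE vE wv (bf_length_sign R a q p); lexgo.
  by move=> /bf_length_eq0 e1; rewrite -[RHS](mulVKg (w * bf_letter (a, p))%g) e1 mulg1.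
(* Otherwise appending the inverse letter would lengthen the word, though it gives back [u]. *)
have ends u r : L (u * bf_letter (a, r))%g = L u + L (bf_letter (a, r)) ->
    ends_in (u * bf_letter (a, r))%g (a, r).
  move=> uE; apply: contrapT => nend.
  have := @bf_length_not_ends_in _ _ R (u * bf_letter (a, r))%g (sinv (a, r)).
  rewrite sinvK => /(_ nend); rewrite bf_letter_inv mulgK -bf_letter_inv uE.
  have := bf_length_letter_gt0 R (a, r); rewrite (bf_length_sign R a (~~ r) r).
  by lexgo.
have ew := ends _ _ wE; have ev := ends _ _ vE.
have [pq] : (a, p) = (a, q) by apply: ends_in_unique ew _; rewrite tipE.
by subst q; congr Edge; rewrite -[LHS](mulgK (bf_letter (a, p))) tipE mulgK.
Qed.

Lemma tdist_metric : is_metric setT tdist.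
Proof.
exact: (tree_dist_metric bf_rooted_gromov).
Qed.

Lemma cayley_dist_eq0 x y : cayley A R x -> cayley A R y ->
  cayley_dist A R x y = 0 -> x = y.
Proof.
move=> xc yc; rewrite /cayley_dist scaler_nat mulr2n minA => e.
have h1 : Order.min (Order.min (height x) (height y)) (c (tip x) (tip y)) <= height x.
  by rewrite !ge_min lexx.
have h2 : Order.min (Order.min (height x) (height y)) (c (tip x) (tip y)) <= height y.
  by rewrite !ge_min lexx orbT.
have h3 : Order.min (Order.min (height x) (height y)) (c (tip x) (tip y)) <= c (tip x) (tip y).
  by rewrite !ge_min lexx !orbT.
apply: cayley_separated => //; by move: h1 h2 h3 e; set mu := Order.min _ _; lexgo.
Qed.

Lemma embed_inj x y : cayley A R x -> cayley A R y -> embed x = embed y -> x = y.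
Proof.
move=> xc yc e; apply: cayley_dist_eq0 => //; rewrite -embed_dist // e.
exact/(dist_eq0 tdist_metric).
Qed.

Lemma cayley_metric : is_metric (cayley A R) (cayley_dist A R).
Proof.
have eq0 := dist_eq0 tdist_metric.
split=> [x y xc yc|x y xc yc|x y xc yc|x y z xc yc zc].
- by rewrite -(embed_dist xc yc); exact: (dist_ge0 tdist_metric).
- split=> [|<-]; first exact: cayley_dist_eq0.
  by rewrite -(embed_dist xc xc); exact/eq0.
- rewrite -(embed_dist xc yc) -(embed_dist yc xc); exact: (dist_sym tdist_metric).
rewrite -(embed_dist xc yc) -(embed_dist yc zc) -(embed_dist xc zc).
exact: (dist_triangle tdist_metric).
Qed.

Lemma half_mono (u v : Lam) : u <= v -> 2^-1 *: u <= 2^-1 *: v.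
Proof.
move: (2^-1 *: u) (2^-1 *: v) (lex_half u) (lex_half v) => u' v'; lexlra.
Qed.

Lemma cayley_hyperbolic : zero_hyperbolic (cayley A R) (cayley_dist A R).
Proof.
move=> v x y z vc xc yc zc; rewrite /gromov_product.
have := tree_dist_four_point bf_rooted_gromov
  (embed x) (embed y) (embed v) (embed z).
rewrite (embed_dist xc yc) (embed_dist vc zc) (embed_dist xc vc) (embed_dist yc zc).
rewrite (embed_dist xc zc) (embed_dist yc vc).
have xv := dist_sym cayley_metric xc vc; have yv := dist_sym cayley_metric yc vc.
rewrite xv yv le_max ge_min => /orP[h|h]; apply/orP; [right|left];
  by apply: half_mono; move: h; lexgo.
Qed.

Lemma cayley_act_stable u x : cayley A R x -> cayley A R (cayley_act A R u x).
Proof.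
case: x => // w a p t [/andP[t0 t1] nend] /=; case: asboolP => [e|//] /=.
  split; first by apply/andP; split; lra.
  (* By [e] multiplication by [a^p] shortens [u * w], whereas [e'] says that it lengthens it. *)
  rewrite negbK => e'; have := bf_length_ends_in R e'; rewrite mulgK.
  have := bf_length_ends_in R e; rewrite -bf_letter_inv /sinv /= negbK.
  have := bf_length_letter_gt0 R (a, p); rewrite (bf_length_sign R a (~~ p) p).
  by lexgo.
by rewrite t0 t1.
Qed.

Lemma embed_act u x : cayley A R x ->
  embed (cayley_act A R u x) = tree_act u (embed x).
Proof.
move=> xc; apply: tree_point_eq; rewrite embedE; last exact: cayley_act_stable.
apply/funext => z; rewrite [RHS]/= -[RHS]/(sval (embed x) (u^-1 * z)%g) embedE //.
have uc := cayley_act_stable u xc; move: xc uc.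
case: x => [w _ _|w a p t xc].
  have V (v y : bigfree A) : pfun v (L v) y = bdist y v.
    by rewrite /point_fun min_r ?overlap_le // overlapC.
  by rewrite /= !V bf_dist_invl.
have edge v q (s : R) (y : bigfree A) : cayley A R (Edge v a q s) -> 0 < s ->
    pfun (tip (Edge v a q s : prepoint A R)) (height (Edge v a q s : prepoint A R)) y =
    Order.max (bdist y v - s *: L (bf_letter (a, true)))
      (bdist y (v * bf_letter (a, q))%g - (1 - s) *: L (bf_letter (a, true))).
  move=> vc s0; rewrite height_edge !(bf_length_sign R a true q).
  apply: point_fun_edge; first exact: scaled_letter_ge0.
    exact: scaled_letterD.
  exact: bf_length_edge vc.
have [t01 _] := xc; have [t0 t1] := andP t01.
rewrite (edge w p t _ xc t0) !bf_dist_invl /=.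
case: asboolP => [e|ne] uc.
  (* The reversed edge exchanges the ends and turns [t] into [1 - t], which only swaps the arguments
     of the maximum. *)
  rewrite (edge _ _ _ _ uc) ?subr_gt0 //.
  rewrite -[in (_, ~~ p)]/(sinv (a, p)).
  have -> : bf_letter (a, ~~ p) = (bf_letter (a, p))^-1%g by rewrite -bf_letter_inv.
  by rewrite mulgK subKr maxC mulgA.
by rewrite (edge _ _ _ _ uc) // mulgA.
Qed.

(** The action laws are pulled back along the injective equivariant [embed], which avoids following
    edge reversals through products. *)
Lemma cayley_act_isometric :
  isometric_action (cayley A R) (cayley_dist A R) (cayley_act A R).
Proof.
have [_ a1 aM ai] := tree_act_isometric.
split=> [u x|x xc|g h x xc|u x y xc yc].
- exact: cayley_act_stable.
- apply: embed_inj => //; first exact: cayley_act_stable.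
  by rewrite embed_act // a1.
- have hc := cayley_act_stable h xc.
  apply: embed_inj; try exact: cayley_act_stable.
  by rewrite !embed_act // aM.
by rewrite -!embed_dist ?embed_act ?ai //; exact: cayley_act_stable.
Qed.

Lemma cayley_not_tree (a b : A) : (a < b)%O ->
  ~ is_tree (cayley A R) (cayley_dist A R).
Proof.
move=> ab [_ geo _ _].
pose va : prepoint A R := Vertex (bf_letter (a, true)).
have ba : L (bf_letter (b, true)) < L (bf_letter (a, true)).
  apply/lex_ltE; exists a => [|e ea]; rewrite !bf_length_letter ?eqxx /=.
    by rewrite gt_eqF // ltr01.
  by rewrite !gt_eqF //; exact: lt_trans ea ab.
have b0 := bf_length_letter_gt0 R (b, true).
have [//|//|S [s [t [f [st Xf df _ [fs ft]]]]]] := geo (Vertex 1%g) va.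
have c1 g : c 1%g g = 0.
  by apply/le_anti; rewrite overlap_ge0 andbT -(bf_length1 A R) overlap_le.
have d1 x : cayley A R x -> cayley_dist A R (Vertex 1%g) x = height x.
  move=> /height_bounds/andP[x0 _]; rewrite /cayley_dist /= bf_length1 c1.
  by rewrite (min_r x0) minxx scaler0 add0r subr0.
have tE : t = s + L (bf_letter (a, true)).
  have := df s t; rewrite !lexx st => /(_ isT isT); rewrite fs ft d1 //= absv_le.
    by lexgo.
  by move: st; lexgo.
(* Since [a < b], [L(b)] lies lexicographically below [L(a)], so the segment must have a point at
   this distance from its start. *)
pose r : Lam := s + L (bf_letter (b, true)).
have sr : s <= r by rewrite /r; move: b0; lexgo.
have rt : r <= t by rewrite /r tE; move: ba; lexgo.
have xc : cayley A R (f r) by apply: Xf; rewrite sr.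
have hx : height (f r) = L (bf_letter (b, true)).
  by rewrite -d1 // -fs df ?lexx ?st ?sr ?rt // absv_le /r; [lexgo|move: b0; lexgo].
have : cayley_dist A R (f r) va = L (bf_letter (a, true)) - L (bf_letter (b, true)).
  by rewrite -ft df ?lexx ?st ?sr ?rt // absv_le /r tE; [lexgo|move: ba; lexgo].
rewrite /cayley_dist scaler_nat mulr2n hx [height va]/= [tip va]/= => e.
(* The distances to both ends make the minimum in [d] equal to [L(b)]. The tip therefore overlaps
   the letter [a] positively, hence contains it entirely: too long for a vertex of height [L(b)]. An
   edge point is excluded by its fractional coordinate. *)
have le : L (bf_letter (b, true)) <= c (bf_letter (a, true)) (tip (f r)).
  move: e; rewrite (overlapC R (tip _)); set mu := Order.min _ _ => e.
  have h : mu <= c (bf_letter (a, true)) (tip (f r)) by rewrite !ge_min lexx !orbT.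
  by move: e h; lexgo.
have la : L (1 * bf_letter (a, true))%g = L 1%g + L (bf_letter (a, true)).
  by rewrite mul1g bf_length1 add0r.
have := overlap_step (tip (f r)) la; rewrite mul1g bf_length1.
case=> [le'|cE]; first by move: le le' b0; lexgo.
have := overlap_le R (tip (f r)) (bf_letter (a, true)); rewrite overlapC cE.
move: xc hx; case: (f r) => [w|w i p q] xc hx le'; first by move: hx le' ba => /=; lexgo.
have [q01 _] := xc; move: hx; rewrite height_edge => /(congr1 (fun u : Lam => u i)).
by rewrite lexpowD lexpowZ !bf_length_letter eqxx mulr1 => /(nat_add_fraction q01).
Qed.

End CayleyTree.

Theorem mainTheorem2 (d : Order.disp_t) (A : wellOrderType d) (R : realType) :
  [/\ is_metric (cayley A R) (cayley_dist A R),
      zero_hyperbolic (cayley A R) (cayley_dist A R),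
      isometric_action (cayley A R) (cayley_dist A R) (cayley_act A R),
      (exists (T : Type) (dist : T -> T -> lexpow A R)
              (act : bigfree A -> T -> T) (f : prepoint A R -> T),
         [/\ is_tree setT dist,
             isometric_action setT dist act,
             (forall x y, cayley A R x -> cayley A R y ->
                dist (f x) (f y) = cayley_dist A R x y)
           & (forall u x, cayley A R x -> f (cayley_act A R u x) = act u (f x))])
    & order_type_omega A -> ~ is_tree (cayley A R) (cayley_dist A R)].
Proof.
split.
- exact: cayley_metric.
- exact: cayley_hyperbolic.
- exact: cayley_act_isometric.
- exists (tree_point (@bf_length d A R) (@overlap d A R)), (tree_dist (c := @overlap d A R)),
    (@tree_act d A R), (@embed d A R); split.
  + exact: (tree_point_tree (bf_rooted_gromov A R)).
  + exact: tree_act_isometric.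
  + exact: embed_dist.
  + exact: embed_act.
move=> [f [_ fmono]]; apply: (@cayley_not_tree _ _ _ (f 0%N) (f 1%N)).
by rewrite ltNge fmono.
Qed.
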